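(* Let $T$ be an affine $\mathcal L$-theory and $T_{\mathrm{CR}}=T\cup\mathrm{CR}_{\mathcal L}$. Then: (1) the set of affine consequences of $T_{\mathrm{CR}}$ is equivalent to $T$; (2) $T_{\mathrm{CR}}$ has delta-convex reduction; (3) for every tuple of variables $x$, the map $\rho^{\mathrm{aff}}:S^{\mathrm{cont}}_x(T_{\mathrm{CR}})\to S^{\mathrm{aff}}_x(T)$ sending a continuous type to its restriction to affine formulas is a homeomorphism and an isometry for the type distance $\partial$; (4) if $T$ is complete as an affine theory, then $T_{\mathrm{CR}}$ is complete as a continuous logic theory.
   Context: Affine logic is the fragment of continuous logic (convex moduli) with formulas built from atomic ones by real affine combinations and $\sup,\inf$. $\mathrm{CR}_{\mathcal L}$ (the convex realization property) is the set of continuous axioms $$\sup_{x_0,\dots,x_{m-1},y}\inf_z\bigvee_{i<n}\Big|\varphi_i(z,y)-\sum_{j<m}\lambda_j\varphi_i(x_j,y)\Big|=0$$ for all affine formulas $\varphi_i(x,y)$ and all $\lambda_j\ge0$ with $\sum_j\lambda_j=1$. A continuous theory $Q$ has delta-convex reduction if every continuous formula can be uniformly approximated modulo $Q$ by delta-convex formulas, i.e. differences of formulas of the form $\max_{i<n}\varphi_i$ with $\varphi_i$ affine. $S^{\mathrm{cont}}_x(Q)$ is the usual continuous type space, $S^{\mathrm{aff}}_x(T)$ the space of affine types of $x$-tuples in models of $T$, both with the logic (pointwise) topology. For finite $x$, the type distance is $\partial(p,q)=\inf\{d(a,b): a\models p,\ b\models q$ in a common model$\}$ (with the sum metric on tuples);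 for countable $x$ one uses the corresponding uniformity/metric $d(a,b)=\sum_i2^{-i}d(a_i,b_i)$. $T$ complete means all models of $T$ are affinely equivalent. *)

(* Defs.v *)
From HB Require Import structures.
From mathcomp Require Import all_boot all_order all_algebra.
From mathcomp Require Import all_classical all_reals all_analysis.

Set Implicit Arguments.
Unset Strict Implicit.
Unset Printing Implicit Defensive.

Import Order.TTheory GRing.Theory Num.Theory.
Import numFieldNormedType.Exports.

Local Open Scope classical_set_scope.
Local Open Scope ring_scope.

(* Complete metric spaces.  [Complete] includes a point, so they are nonempty. *)
#[short(type="completeMetricType")]
HB.structure Definition CompleteMetric (R : numDomainType) :=
  {M of Metric R M & Complete M}.

(* Moduli follow the inverse convention: a map [f] respects the modulus [D]
   when [D (d (f a) (f b)) <= d a b].  With this convention it is convexity of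
   [D] that makes the condition stable under averaging. *)
Record modulus (R : realType) := Modulus {
  modulus_fun :> R -> R ;
  modulus0 : modulus_fun 0 = 0 ;
  modulus_gt0 : forall t, 0 < t -> 0 < modulus_fun t ;
  modulus_convex :
    convex_function (`[0, +oo[%classic : set R) (modulus_fun : R -> R^o) }.

Record signature (R : realType) := Signature {
  func_symbol : Type ;
  func_arity : func_symbol -> nat ;
  func_modulus : func_symbol -> modulus R ;
  pred_symbol : Type ;
  pred_arity : pred_symbol -> nat ;
  pred_modulus : pred_symbol -> modulus R ;
  pred_lower : pred_symbol -> R ;
  pred_upper : pred_symbol -> R ;
  pred_lower_le : forall P, pred_lower P <= pred_upper P ;
  diameter : R ;
  diameter_ge0 : 0 <= diameter }.

Record structure (R : realType) (L : signature R) := Structure {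
  carrier :> completeMetricType R ;
  mdist_diameter : forall x y : carrier, mdist x y <= diameter L ;
  func_interp : forall f : func_symbol L, ('I_(func_arity f) -> carrier) -> carrier ;
  func_interp_modulus : forall (f : func_symbol L) (a b : 'I_(func_arity f) -> carrier),
    func_modulus f (mdist (func_interp a) (func_interp b))
      <= \sum_i mdist (a i) (b i) ;
  pred_interp : forall P : pred_symbol L, ('I_(pred_arity P) -> carrier) -> R ;
  pred_interp_modulus : forall (P : pred_symbol L) (a b : 'I_(pred_arity P) -> carrier),
    pred_modulus P `|pred_interp a - pred_interp b|
      <= \sum_i mdist (a i) (b i) ;
  pred_interp_bound : forall (P : pred_symbol L) (a : 'I_(pred_arity P) -> carrier),
    pred_lower P <= pred_interp a <= pred_upper P }.

Inductive term (R : realType) (L : signature R) (V : Type) : Type :=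
| TVar of V
| TApp (f : func_symbol L) of 'I_(func_arity f) -> term L V.

(* Continuous formulas with free variables in [V]; a quantifier binds the
   variable [None] of a formula over [option V].  Connectives are arbitrary
   continuous functions on R^n. *)
Inductive formula (R : realType) (L : signature R) (V : Type) : Type :=
| FPred (P : pred_symbol L) of 'I_(pred_arity P) -> term L V
| FDist of term L V & term L V
| FConn (n : nat) of continuousType 'rV[R]_n R & 'I_n -> formula L V
| FSup of formula L (option V)
| FInf of formula L (option V).

Arguments TVar {R L V}.
Arguments TApp {R L V}.
Arguments FPred {R L V}.
Arguments FDist {R L V}.
Arguments FConn {R L V n}.
Arguments FSup {R L V}.
Arguments FInf {R L V}.

Definition sentence (R : realType) (L : signature R) := formula L void.

Fixpoint eval_term (R : realType) (L : signature R) (M : structure L)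
    (V : Type) (t : term L V) (e : V -> M) : M :=
  match t with
  | TVar v => e v
  | TApp f ts => func_interp (fun i => eval_term (ts i) e)
  end.

Fixpoint eval_formula (R : realType) (L : signature R) (M : structure L)
    (V : Type) (phi : formula L V) : (V -> M) -> R :=
  match phi with
  | FPred P ts => fun e => pred_interp (fun i => eval_term (ts i) e)
  | FDist t1 t2 => fun e => mdist (eval_term t1 e) (eval_term t2 e)
  | FConn n u phis => fun e => u (\row_i eval_formula (phis i) e)
  | FSup phi => fun e => sup (range (fun x => eval_formula phi (oapp e x)))
  | FInf phi => fun e => inf (range (fun x => eval_formula phi (oapp e x)))
  end.

Definition eval_sentence (R : realType) (L : signature R) (M : structure L)
  (phi : sentence L) : R := eval_formula phi (@of_void M).

Definition affine_function (R : realType) (n : nat) (u : 'rV[R]_n -> R) : Prop :=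
  exists (c : R) (w : 'I_n -> R), forall v, u v = c + \sum_i w i * v 0 i.

Fixpoint affine (R : realType) (L : signature R) (V : Type)
    (phi : formula L V) : Prop :=
  match phi with
  | FPred _ _ => True
  | FDist _ _ => True
  | FConn n u phis => affine_function u /\ forall i, affine (phis i)
  | FSup phi => affine phi
  | FInf phi => affine phi
  end.

Definition affine_formula (R : realType) (L : signature R) (V : Type) :=
  {phi : formula L V | affine phi}.

Fixpoint rename_term (R : realType) (L : signature R) (V W : Type) (s : V -> W)
    (t : term L V) : term L W :=
  match t with
  | TVar v => TVar (s v)
  | TApp f ts => TApp f (fun i => rename_term s (ts i))
  end.

Fixpoint rename (R : realType) (L : signature R) (V W : Type) (s : V -> W)
    (phi : formula L V) : formula L W :=
  match phi with
  | FPred P ts => FPred P (fun i => rename_term s (ts i))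
  | FDist t1 t2 => FDist (rename_term s t1) (rename_term s t2)
  | FConn n u phis => FConn u (fun i => rename s (phis i))
  | FSup phi => FSup (rename (omap s) phi)
  | FInf phi => FInf (rename (omap s) phi)
  end.

Definition ord0_elim (A : Type) (i : 'I_0) : A :=
  False_rect A (notF (ltn_ord i)).

Fixpoint quantify_ord (R : realType) (L : signature R)
    (q : forall V, formula L (option V) -> formula L V) (k : nat) (V : Type) :
    formula L (V + 'I_k) -> formula L V :=
  match k with
  | 0 => rename (fun s : V + 'I_0 => match s with
                                   | inl v => v
                                   | inr i => ord0_elim V i
                                   end)
  | k'.+1 => fun phi => quantify_ord q (q _ (rename
      (fun s : V + 'I_k'.+1 => match s with
                | inl v => Some (inl v)
                | inr i => omap inr (unlift ord0 i)
                end) phi))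
  end.

Definition quantify (R : realType) (L : signature R)
    (q : forall V, formula L (option V) -> formula L V) (I : finType) (V : Type)
    (phi : formula L (V + I)) : formula L V :=
  quantify_ord q (rename
    (fun s => match s with inl v => inl v | inr i => inr (enum_rank i) end) phi).

(* [FSups phi] and [FInfs phi] quantify the finite tuple of variables
   indexed by [I]. *)
Definition FSups (R : realType) (L : signature R) (I : finType) (V : Type)
  (phi : formula L (V + I)) : formula L V := quantify (@FSup R L) phi.

Definition FInfs (R : realType) (L : signature R) (I : finType) (V : Type)
  (phi : formula L (V + I)) : formula L V := quantify (@FInf R L) phi.

Lemma conn_coord_continuous (R : realType) (n : nat) (i : 'I_n) :
  continuous (fun v : 'rV[R]_n => v 0 i : R).
Proof. exact: coord_continuous. Qed.

Lemma conn_abs_continuous (R : realType) :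
  continuous (fun v : 'rV[R]_1 => `|v 0 0|).
Proof.
move=> v; apply: (@continuous_comp _ _ _ (fun v : 'rV[R]_1 => v 0 0 : R) Num.norm).
  exact: conn_coord_continuous.
exact: norm_continuous.
Qed.

Lemma conn_lincomb_continuous (R : realType) (n : nat) (w : 'I_n -> R) :
  continuous (fun v : 'rV[R]_n => \sum_i w i * v 0 i).
Proof.
apply: continuous_big => [|i _ v]; first exact: add_continuous.
apply: (@continuousM R _ (cst (w i))); first exact: cst_continuous.
exact: conn_coord_continuous.
Qed.

Lemma conn_sub_continuous (R : realType) :
  continuous (fun v : 'rV[R]_2 => v 0 0 - v 0 1).
Proof.
by move=> v; apply: (@continuousB R R^o); exact: conn_coord_continuous.
Qed.

Lemma conn_max_continuous (R : realType) (n : nat) :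
  continuous (fun v : 'rV[R]_n.+1 => \big[Num.max/v 0 ord0]_(i < n.+1) v 0 i).
Proof.
elim: (index_enum _) => [|i r IHr] v.
  under eq_fun do rewrite big_nil.
  exact: conn_coord_continuous.
under eq_fun do rewrite big_cons.
apply: (@continuous_max R _ (fun v : 'rV[R]_n.+1 => v 0 i)); last exact: IHr.
exact: conn_coord_continuous.
Qed.

Definition FAbs (R : realType) (L : signature R) (V : Type)
  (phi : formula L V) : formula L V :=
  FConn (mkcts (@conn_abs_continuous R)) (fun=> phi).

Definition FLin (R : realType) (L : signature R) (V : Type) (n : nat)
  (w : 'I_n -> R) (phi : 'I_n -> formula L V) : formula L V :=
  FConn (mkcts (@conn_lincomb_continuous R n w)) phi.

Definition FSub (R : realType) (L : signature R) (V : Type)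
  (phi psi : formula L V) : formula L V :=
  FConn (mkcts (@conn_sub_continuous R)) (fun i => if i == 0 then phi else psi).

Definition FMax (R : realType) (L : signature R) (V : Type) (n : nat)
  (phi : 'I_n.+1 -> formula L V) : formula L V :=
  FConn (mkcts (@conn_max_continuous R n)) phi.

Definition FZero (R : realType) (L : signature R) (V : Type) : formula L V :=
  FLin (fun=> 0 : R) (@ord0_elim (formula L V)).

Inductive condition (R : realType) (L : signature R) : Type :=
| CLe of sentence L & sentence L
| CEq of sentence L & sentence L.

Definition affine_condition (R : realType) (L : signature R)
    (c : condition L) : Prop :=
  match c with
  | CLe phi psi | CEq phi psi => affine phi /\ affine psi
  end.

Definition satisfies (R : realType) (L : signature R) (M : structure L)
    (c : condition L) : Prop :=
  match c with
  | CLe phi psi => eval_sentence M phi <= eval_sentence M psi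
  | CEq phi psi => eval_sentence M phi = eval_sentence M psi
  end.

Definition theory (R : realType) (L : signature R) := set (condition L).

Definition affine_theory (R : realType) (L : signature R) (T : theory L) : Prop :=
  forall c, T c -> affine_condition c.

Definition models (R : realType) (L : signature R) (M : structure L)
  (T : theory L) : Prop := forall c, T c -> satisfies M c.

Definition affine_consequences (R : realType) (L : signature R)
    (Q : theory L) : theory L :=
  [set c | affine_condition c /\
           forall M : structure L, models M Q -> satisfies M c].

Definition equivalent (R : realType) (L : signature R) (T T' : theory L) : Prop :=
  forall M : structure L, models M T <-> models M T'.

Definition affinely_complete (R : realType) (L : signature R) (T : theory L) : Prop :=
  forall M N : structure L, models M T -> models N T ->
  forall phi : sentence L, affine phi -> eval_sentence M phi = eval_sentence N phi.

Definition continuously_complete (R : realType) (L : signature R)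
    (Q : theory L) : Prop :=
  forall M N : structure L, models M Q -> models N Q ->
  forall phi : sentence L, eval_sentence M phi = eval_sentence N phi.

(* The sentence
     sup_{x_0,...,x_(m-1),y} inf_z max_{i<=n}
       |phi_i(z,y) - \sum_(j<m) lambda_j phi_i(x_j,y)|
   where the x_j and z are k-tuples and y is an l-tuple of variables: in
   [phi i], [inl] are the variables of x and [inr] those of y. *)
Definition CR_sentence (R : realType) (L : signature R) (k l m n : nat)
    (lambda : 'I_m -> R) (phi : 'I_n.+1 -> formula L ('I_k + 'I_l)) : sentence L :=
  let y (q : 'I_l) : void + ('I_m * 'I_k + 'I_l) + 'I_k := inl (inr (inr q)) in
  let x (j : 'I_m) (p : 'I_k) : void + ('I_m * 'I_k + 'I_l) + 'I_k :=
    inl (inr (inl (j, p))) in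
  let z (p : 'I_k) : void + ('I_m * 'I_k + 'I_l) + 'I_k := inr p in
  let subst t (s : 'I_k + 'I_l) := match s with inl p => t p | inr q => y q end in
  FSups (FInfs (FMax (fun i : 'I_n.+1 =>
    FAbs (FSub (rename (subst z) (phi i))
               (FLin lambda (fun j => rename (subst (x j)) (phi i))))))).

Definition CR (R : realType) (L : signature R) : theory L :=
  [set c | exists (k l m n : nat) (lambda : 'I_m -> R)
      (phi : 'I_n.+1 -> formula L ('I_k + 'I_l)),
    [/\ forall j, 0 <= lambda j, \sum_j lambda j = 1,
        forall i, affine (phi i) &
        c = CEq (CR_sentence lambda phi) (FZero L void)]].

Arguments CR {R} L _.

Definition T_CR (R : realType) (L : signature R) (T : theory L) : theory L :=
  T `|` CR L.

Definition delta_convex (R : realType) (L : signature R) (V : Type)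
    (phi : formula L V) : Prop :=
  exists (m n : nat) (psi : 'I_m.+1 -> formula L V) (chi : 'I_n.+1 -> formula L V),
    [/\ forall i, affine (psi i), forall i, affine (chi i) &
        phi = FSub (FMax psi) (FMax chi)].

Definition delta_convex_reduction (R : realType) (L : signature R)
    (Q : theory L) : Prop :=
  forall (V : Type) (phi : formula L V) (eps : R), 0 < eps ->
  exists psi : formula L V, delta_convex psi /\
    forall M : structure L, models M Q ->
    forall a : V -> M, `|eval_formula phi a - eval_formula psi a| <= eps.

(* A complete type is identified with the real-valued function it induces on
   formulas; type spaces carry the topology of pointwise convergence. *)
Definition cont_realizes (R : realType) (L : signature R) (X : Type)
    (M : structure L) (a : X -> M) (p : {ptws formula L X -> R}) : Prop :=
  forall phi, p phi = eval_formula phi a.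

Definition aff_realizes (R : realType) (L : signature R) (X : Type)
    (M : structure L) (a : X -> M) (p : {ptws affine_formula L X -> R}) : Prop :=
  forall phi, p phi = eval_formula (sval phi) a.

Definition cont_types (R : realType) (L : signature R) (Q : theory L) (X : Type) :
    set {ptws formula L X -> R} :=
  [set p | exists (M : structure L) (a : X -> M), models M Q /\ cont_realizes a p].

Definition aff_types (R : realType) (L : signature R) (T : theory L) (X : Type) :
    set {ptws affine_formula L X -> R} :=
  [set p | exists (M : structure L) (a : X -> M), models M T /\ aff_realizes a p].

Arguments cont_types {R L} Q X _.
Arguments aff_types {R L} T X _.

Definition S_cont (R : realType) (L : signature R) (Q : theory L) (X : Type) :
  topologicalType := set_type (cont_types Q X).

Definition S_aff (R : realType) (L : signature R) (T : theory L) (X : Type) :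
  topologicalType := set_type (aff_types T X).

Lemma restrict_aff_types (R : realType) (L : signature R) (T : theory L)
    (X : Type) (p : S_cont (T_CR T) X) :
  aff_types T X (fun phi => set_val p (sval phi)).
Proof.
have [M [a [MT ap]]] := set_mem (svalP p).
by exists M, a; split => [c Tc|phi]; [apply: MT; left | exact: ap].
Qed.

Definition rho_aff (R : realType) (L : signature R) (T : theory L) (X : Type)
    (p : S_cont (T_CR T) X) : S_aff T X :=
  exist (fun q => q \in aff_types T X) (fun phi => set_val p (sval phi))
    (mem_set (restrict_aff_types p)).

Definition homeomorphism (X Y : topologicalType) (f : X -> Y) : Prop :=
  continuous f /\
  exists g : Y -> X, [/\ cancel f g, cancel g f & continuous g].

(* Distances between tuples: the sum metric for finite tuples, the metric
   \sum_i 2^-i d(a_i, b_i) for countable ones. *)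
Definition finite_dist (R : realType) (n : nat) (M : metricType R)
  (a b : 'I_n -> M) : \bar R := (\sum_i mdist (a i) (b i))%:E.

Definition countable_dist (R : realType) (M : metricType R)
  (a b : nat -> M) : \bar R :=
  (\sum_(0 <= i <oo) (2^-1 ^+ i * mdist (a i) (b i))%:E)%E.

(* The type distances are [+oo] when the types have no common model. *)
Definition cont_type_dist (R : realType) (L : signature R) (Q : theory L)
    (X : Type) (d : forall M : metricType R, (X -> M) -> (X -> M) -> \bar R)
    (p q : S_cont Q X) : \bar R :=
  ereal_inf [set r | exists (M : structure L) (a b : X -> M),
    [/\ models M Q, cont_realizes a (set_val p), cont_realizes b (set_val q) &
        r = d M a b]].

Definition aff_type_dist (R : realType) (L : signature R) (T : theory L)
    (X : Type) (d : forall M : metricType R, (X -> M) -> (X -> M) -> \bar R)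
    (p q : S_aff T X) : \bar R :=
  ereal_inf [set r | exists (M : structure L) (a b : X -> M),
    [/\ models M T, aff_realizes a (set_val p), aff_realizes b (set_val q) &
        r = d M a b]].

(* Main.v *)
(** Two ingredients.

    (a) In models of CR, the set of values [(psi_j(x, b))_j] taken by finitely
    many affine formulas as [x] varies is convex up to closure, hence determined
    by its support function, whose values [sup_x (\sum_j w_j psi_j(x, b))] are
    again affine formulas.  By induction, every continuous formula is, uniformly
    over all models of CR, a uniformly continuous function of finitely many
    affine formulas; this yields delta-convex reduction and shows that a
    continuous type is determined, with continuous dependence, by its affine part.

    (b) Every structure [M] embeds diagonally into an ultraproduct of the powers
    [M^(n+1)] with averaged distance and predicates.  Averaging commutes with
    affine formulas, so the embedding preserves them and their theory.  The
    ultraproduct satisfies CR: choosing each coordinate among those of the [x_j]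
    greedily realises the prescribed averages with error [O(1 / sqrt n)]. *)

(* The proof needs estimates uniform over all models. Instead of invoking compactness of type
   spaces, ingredient (a) is stated for pairs of models: finitely many affine formulas and a
   tolerance [d] control a given formula up to [eps] across any two models of CR. This statement
   serves three times. With equal affine values, it says that types and complete theories are
   determined by their affine part; with nearby values, it is continuity of the inverse of
   [rho_aff]; with a finite net of values, it gives delta-convex approximations. In (b) a single
   power of [M] does not suffice, since averages are realised there only up to an error depending on
   [n]; the limit along the ultrafilter removes it. Convexity of the moduli enters through Jensen's
   inequality: symbols must keep their moduli under averaged distances. Structures have complete
   carriers, hence the saturation argument. The diagonal preserves affine values and distances,
   which gives conservativity and surjectivity of [rho_aff] and, together with (a), the isometry. *)
From HB Require Import structures.
Require Import Defs.
From mathcomp Require Import all_boot all_order all_algebra.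
From mathcomp Require Import all_classical all_reals all_analysis.
From mathcomp Require Import ring lra.

Set Implicit Arguments.
Unset Strict Implicit.
Unset Printing Implicit Defensive.

Import Order.TTheory GRing.Theory Num.Theory.
Import numFieldNormedType.Exports.

Local Open Scope classical_set_scope.
Local Open Scope ring_scope.

(** * Evaluation of formulas *)

Section SupRange.
Context {R : realType} {T : pointedType}.
Implicit Types (f : T -> R) (c B : R).

Lemma sup_range_leP f B c : (forall t, `|f t| <= B) ->
  sup (range f) <= c <-> forall t, f t <= c.
Proof.
move=> fB; split=> [fc t|fc]; last first.
  by apply: ge_sup; [exists (f point), point|move=> _ [t _ <-]].
apply: le_trans fc; apply: ub_le_sup; last by exists t.
by exists B => _ [s _ <-]; have /ler_normlP[] := fB s.
Qed.

Lemma inf_range_geP f B c : (forall t, `|f t| <= B) ->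
  c <= inf (range f) <-> forall t, c <= f t.
Proof.
move=> fB; split=> [fc t|fc]; last first.
  by apply: lb_le_inf; [exists (f point), point|move=> _ [t _ <-]].
apply: (le_trans fc); apply: ge_inf; last by exists t.
by exists (- B) => _ [s _ <-]; have /ler_normlP[] := fB s; rewrite lerNl.
Qed.

Lemma sup_range_bound f B : (forall t, `|f t| <= B) -> `|sup (range f)| <= B.
Proof.
move=> fB; apply/ler_normlP; split; last first.
  by apply/(sup_range_leP _ fB) => t; have /ler_normlP[] := fB t.
have fle := iffLR (sup_range_leP _ fB) (lexx _) point.
by have /ler_normlP[fBp _] := fB point; lra.
Qed.

Lemma inf_range_bound f B : (forall t, `|f t| <= B) -> `|inf (range f)| <= B.
Proof.
move=> fB; apply/ler_normlP; split.
  rewrite lerNl; apply/(inf_range_geP _ fB) => t.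
  by have /ler_normlP[] := fB t; rewrite lerNl.
have fge := iffLR (inf_range_geP _ fB) (lexx _) point.
by have /ler_normlP[_ fBp] := fB point; lra.
Qed.

End SupRange.

Lemma eval_rename_term (R : realType) (L : signature R) (M : structure L)
    (V W : Type) (s : V -> W) (t : term L V) (e : W -> M) :
  eval_term (rename_term s t) e = eval_term t (e \o s).
Proof.
elim: t => [v|f ts IH] //=; congr func_interp; apply: funext => i; exact: IH.
Qed.

Lemma eval_rename (R : realType) (L : signature R) (M : structure L)
    (V W : Type) (s : V -> W) (phi : formula L V) (e : W -> M) :
  eval_formula (rename s phi) e = eval_formula phi (e \o s).
Proof.
elim: phi W s e => {V} [V P ts|V t1 t2|V n u phis IH|V phi IH|V phi IH] W s e /=.
- by congr pred_interp; apply: funext => i; rewrite eval_rename_term.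
- by rewrite !eval_rename_term.
- by congr (u _); apply/rowP => i; rewrite !mxE IH.
- apply: (congr1 (fun f => sup (range f))); apply: funext => x; rewrite IH; congr eval_formula.
  by apply: funext => -[].
- apply: (congr1 (fun f => inf (range f))); apply: funext => x; rewrite IH; congr eval_formula.
  by apply: funext => -[].
Qed.

Lemma affine_rename (R : realType) (L : signature R) (V W : Type) (s : V -> W)
    (phi : formula L V) : affine phi -> affine (rename s phi).
Proof.
elim: phi W s => {V} [V P ts|V t1 t2|V n u phis IH|V phi IH|V phi IH] W s //=.
- by move=> [u_aff phi_aff]; split=> // i; exact: IH.
- exact: IH.
- exact: IH.
Qed.


(** Supports are lists tested by [List.In] because [V] is an arbitrary type, without decidable
    equality. *)
Lemma support_big (V : Type) (n : nat) (S : 'I_n -> seq V) :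
  exists S' : seq V, forall i v, List.In v (S i) -> List.In v S'.
Proof.
elim: n S => [|n IH] S; first by exists [::] => -[].
have [S' SS'] := IH (fun i => S (lift ord0 i)).
exists (S ord0 ++ S') => i v; rewrite List.in_app_iff.
by case: (unliftP ord0 i) => [j|] -> vS; [right; exact: SS' vS|left].
Qed.

Lemma support_option (V : Type) (S : seq (option V)) :
  exists S' : seq V, forall v, List.In (Some v) S -> List.In v S'.
Proof.
elim: S => [|[w|] S [S' HS]]; first by exists [::].
- by exists (w :: S') => v [[->]|/HS]; [left|right].
- by exists S' => v [//|/HS].
Qed.

Lemma term_support (R : realType) (L : signature R) (V : Type) (t : term L V) :
  exists S : seq V, forall (M : structure L) (e e' : V -> M),
    (forall v, List.In v S -> e v = e' v) -> eval_term t e = eval_term t e'.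
Proof.
elim: t => [v|f ts /choice[S HS]]; first by exists [:: v] => M e e'; apply; left.
have [S' SS'] := support_big S.
exists S' => M e e' ee' /=; congr func_interp; apply: funext => i.
by apply: HS => v vS; apply: ee'; exact: SS' vS.
Qed.

(** Variables range over an arbitrary type, whereas CR speaks of finite tuples only; a finite
    support lets an arbitrary assignment of parameters be replaced by a finite tuple. *)
Lemma formula_support (R : realType) (L : signature R) (V : Type)
    (phi : formula L V) :
  exists S : seq V, forall (M : structure L) (e e' : V -> M),
    (forall v, List.In v S -> e v = e' v) ->
    eval_formula phi e = eval_formula phi e'.
Proof.
have ext W (psi : formula L (option W)) S S' :
    (forall v : W, List.In (Some v) S -> List.In v S') ->
    (forall (M : structure L) (e e' : option W -> M),
      (forall v, List.In v S -> e v = e' v) ->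
      eval_formula psi e = eval_formula psi e') ->
    forall (M : structure L) (e e' : W -> M),
      (forall v, List.In v S' -> e v = e' v) ->
      (fun x => eval_formula psi (oapp e x)) =
      (fun x => eval_formula psi (oapp e' x)).
  move=> SS' HS M e e' ee'; apply: funext => x; apply: HS => -[v|] //= vS.
  exact/ee'/SS'.
elim: phi => {V} [V P ts|V t1 t2|V n u phis /choice[S HS]|V phi [S HS]|V phi [S HS]].
- have /choice[S HS] := fun i => term_support (ts i).
  have [S' SS'] := support_big S.
  exists S' => M e e' ee' /=; congr pred_interp; apply: funext => i.
  by apply: HS => v vS; apply: ee'; exact: SS' vS.
- have [S1 HS1] := term_support t1; have [S2 HS2] := term_support t2.
  exists (S1 ++ S2) => M e e' ee' /=; rewrite (HS1 _ e e') ?(HS2 _ e e') //.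
    by move=> v vS; apply: ee'; apply/List.in_app_iff; right.
  by move=> v vS; apply: ee'; apply/List.in_app_iff; left.
- have [S' SS'] := support_big S.
  exists S' => M e e' ee' /=; congr (u _); apply/rowP => i; rewrite !mxE.
  by apply: HS => v vS; apply: ee'; exact: SS' vS.
- have [S' SS'] := support_option S.
  by exists S' => M e e' ee' /=; rewrite (ext _ _ _ _ SS' HS _ _ _ ee').
- have [S' SS'] := support_option S.
  by exists S' => M e e' ee' /=; rewrite (ext _ _ _ _ SS' HS _ _ _ ee').
Qed.

Definition boxn (R : realType) (n : nat) (B : R) : set 'rV[R]_n :=
  [set v | forall i, `|v 0 i| <= B].

Lemma box_compact (R : realType) (n : nat) (B : R) : compact (@boxn R n B).
Proof.
rewrite (_ : boxn B = [set v | forall i, `[- B, B]%classic (v 0 i)]).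
  apply: (@rV_compact R n (fun=> `[- B, B]%classic)) => i.
  exact: segment_compact.
by apply/seteqP; split=> v vB i; have := vB i; rewrite /= in_itv/= ler_norml.
Qed.

Lemma box_bounded (R : realType) (n : nat) (u : 'rV[R]_n -> R) (B : R) :
  continuous u -> exists C, 0 <= C /\ forall v, boxn B v -> `|u v| <= C.
Proof.
move=> u_cont.
have /compact_bounded[C [_ uC]] : compact (u @` boxn B).
  apply: continuous_compact; last exact: box_compact.
  exact: continuous_subspaceT.
have C1 : C < Num.max 0 (C + 1) by rewrite lt_max; apply/orP; right; lra.
exists (Num.max 0 (C + 1)); rewrite le_max lexx; split=> // v vB.
by apply: (uC _ C1); exists v.
Qed.

Lemma box_unif_continuous (R : realType) (n : nat) (u : 'rV[R]_n -> R) (B eps : R) :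
  continuous u -> 0 < eps -> exists2 d, 0 < d & forall v w : 'rV[R]_n,
    boxn B v -> (forall i, `|v 0 i - w 0 i| <= d) -> `|u v - u w| <= eps.
Proof.
move=> u_cont eps0.
(* Near-covering compactness merges the local tolerances into one [d] valid on the whole box, with
   [w] allowed to leave the box. *)
have /compact_near_coveringP ncov := @box_compact R n B.
have near_box (v : 'rV[R]_n) : boxn B v -> \forall v' \near v & d \near 0^'+,
    forall w, ball v' d w -> `|u v' - u w| <= eps.
  move=> _.
  have /nbhs_ballP[d /= d0 ud] : \forall w \near v, `|u v - u w| < eps / 2.
    by have /cvgrPdist_lt := u_cont v; apply; lra.
  exists (ball v (d / 2), [set d' | d' < d / 2]) => /=.
    split; first by apply: nbhsx_ballx; lra.
    by apply: nbhs_right_lt; lra.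
  move=> [v' d'] /= [vv' dd'] w v'w.
  have h1 : `|u v - u v'| < eps / 2 by apply: ud; apply: le_ball vv'; lra.
  have h2 : `|u v - u w| < eps / 2.
    apply: ud; rewrite (splitr d); apply: (ball_triangle vv').
    by apply: le_ball v'w; lra.
  rewrite (_ : u v' - u w = (u v - u w) - (u v - u v')); last by ring.
  by apply: (le_trans (ler_normB _ _)); lra.
have near_ud := ncov _ _ (fun d v => forall w, ball v d w -> `|u v - u w| <= eps)
  _ near_box.
near (0 : R)^'+ => d.
have ud : boxn B `<=` [set v | forall w, ball v d w -> `|u v - u w| <= eps].
  by near: d; exact: near_ud.
have d0 : 0 < d by [].
exists (d / 2) => [|v w vB vw]; first by lra.
apply: ud => //; split=> // i j; rewrite ord1 /ball /=.
by apply: le_lt_trans (vw j) _; lra.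
Unshelve. all: by end_near. Qed.

(** The bound holds in all structures at once: the signature bounds predicates and distances, and a
    connective is bounded on a compact box. It keeps [sup] and [inf] away from their default values
    and makes finite nets of values possible. *)
Lemma formula_bounded (R : realType) (L : signature R) (V : Type)
    (phi : formula L V) :
  exists2 B, 0 <= B & forall (M : structure L) (e : V -> M),
    `|eval_formula phi e| <= B.
Proof.
elim: phi => {V} [V P ts|V t1 t2|V n u phis IH|V phi [B B0 IH]|V phi [B B0 IH]] /=.
- exists (`|pred_lower P| + `|pred_upper P|) => [|M e]; first by rewrite addr_ge0.
  have /andP[] := pred_interp_bound (fun i => eval_term (ts i) e).
  rewrite ler_norml => h1 h2.
  have := ler_norm (pred_upper P); have := ler_norm (- pred_lower P).
  have := normr_ge0 (pred_upper P); have := normr_ge0 (pred_lower P).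
  by rewrite normrN => *; apply/andP; split; lra.
- exists (diameter L) => [|M e]; first exact: diameter_ge0.
  by rewrite ger0_norm ?mdist_ge0// mdist_diameter.
- have {IH} IH i : exists B, forall (M : structure L) (e : V -> M),
    `|eval_formula (phis i) e| <= B by have [B _ HB] := IH i; exists B.
  have {IH} [B IH] := choice IH.
  have [C [C0 HC]] := @box_bounded R n u (\sum_i `|B i|) (@cts_fun _ _ u).
  exists C => // M e; apply: HC => i; rewrite mxE (le_trans (IH _ _ _))//.
  by rewrite (bigD1 i)//= (le_trans (ler_norm _))// lerDl sumr_ge0.
- by exists B => // M e; apply: sup_range_bound => x; exact: IH.
- by exists B => // M e; apply: inf_range_bound => x; exact: IH.
Qed.

Definition join_env (M V I : Type) (e : V -> M) (f : I -> M) (s : V + I) : M :=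
  match s with inl v => e v | inr i => f i end.

(** The predicate [C] stands for a comparison with a constant, [_ <= c] for suprema and [c <= _] for
    infima, so a single induction treats both quantifiers. *)
Lemma eval_quantify (R : realType) (L : signature R) (M : structure L)
    (q : forall V, formula L (option V) -> formula L V) (C : R -> Prop)
    (hq : forall V (phi : formula L (option V)) (e : V -> M),
      C (eval_formula (q V phi) e) <-> forall x, C (eval_formula phi (oapp e x)))
    (I : finType) (V : Type) (phi : formula L (V + I)) (e : V -> M) :
  C (eval_formula (quantify q phi) e) <->
  forall f : I -> M, C (eval_formula phi (join_env e f)).
Proof.
have key (k : nat) (W : Type) (psi : formula L (W + 'I_k)) (e' : W -> M) :
    C (eval_formula (quantify_ord q psi) e') <->
    forall f : 'I_k -> M, C (eval_formula psi (join_env e' f)).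
  elim: k W psi e' => [|k IH] W psi e' /=.
    have env0 f : join_env e' f =
        e' \o (fun s : W + 'I_0 => match s with inl v => v | inr i => ord0_elim W i end).
      by apply: funext => -[v|[]].
    rewrite eval_rename; split=> [h f|/(_ (fun=> point))]; last by rewrite env0.
    by rewrite env0.
  rewrite IH; split=> [h f|h f].
    have /(_ (f ord0)) := iffLR (hq _ _ _) (h (fun i => f (lift ord0 i))).
    rewrite eval_rename; congr (C (eval_formula _ _)); apply: funext => -[v|i] //=.
    by case: (unliftP ord0 i) => [j|] ->.
  apply/hq => x.
  have := h (fun i => oapp f x (unlift ord0 i)).
  rewrite eval_rename; congr (C (eval_formula _ _)); apply: funext => -[v|i] //=.
  by case: (unliftP ord0 i).
rewrite /quantify key; split=> h f.
  have := h (fun i => f (enum_val i)); rewrite eval_rename.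
  congr (C (eval_formula _ _)); apply: funext => -[v|i] //=.
  by rewrite enum_rankK.
have := h (fun i => f (enum_rank i)); rewrite eval_rename.
by congr (C (eval_formula _ _)); apply: funext => -[v|i].
Qed.

Section EvalConnectives.
Context {R : realType} {L : signature R} {M : structure L}.

Lemma eval_FSup_le (V : Type) (phi : formula L (option V)) (e : V -> M) c :
  eval_formula (FSup phi) e <= c <-> forall x, eval_formula phi (oapp e x) <= c.
Proof. by have [B _ HB] := formula_bounded phi; exact: sup_range_leP. Qed.

Lemma eval_FInf_ge (V : Type) (phi : formula L (option V)) (e : V -> M) c :
  c <= eval_formula (FInf phi) e <-> forall x, c <= eval_formula phi (oapp e x).
Proof. by have [B _ HB] := formula_bounded phi; exact: inf_range_geP. Qed.

Lemma eval_FSups_le (I : finType) (V : Type) (phi : formula L (V + I)) (e : V -> M) c :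
  eval_formula (FSups phi) e <= c <->
  forall f : I -> M, eval_formula phi (join_env e f) <= c.
Proof.
apply: (@eval_quantify R L M _ (fun r => r <= c)) => W psi e'.
exact: eval_FSup_le.
Qed.

Lemma eval_FInfs_ge (I : finType) (V : Type) (phi : formula L (V + I)) (e : V -> M) c :
  c <= eval_formula (FInfs phi) e <->
  forall f : I -> M, c <= eval_formula phi (join_env e f).
Proof.
apply: (@eval_quantify R L M _ (fun r => c <= r)) => W psi e'.
exact: eval_FInf_ge.
Qed.

Lemma eval_FLin (V : Type) (n : nat) (w : 'I_n -> R) (phi : 'I_n -> formula L V)
    (e : V -> M) :
  eval_formula (FLin w phi) e = \sum_i w i * eval_formula (phi i) e.
Proof. by apply: eq_bigr => i _; rewrite mxE. Qed.

Lemma eval_FSub (V : Type) (phi psi : formula L V) (e : V -> M) :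
  eval_formula (FSub phi psi) e = eval_formula phi e - eval_formula psi e.
Proof. by rewrite /=; congr (_ - _); rewrite mxE. Qed.

Lemma eval_FAbs (V : Type) (phi : formula L V) (e : V -> M) :
  eval_formula (FAbs phi) e = `|eval_formula phi e|.
Proof. by rewrite /=; congr `|_|; rewrite mxE. Qed.

Lemma eval_FZero (V : Type) (e : V -> M) : eval_formula (FZero L V) e = 0.
Proof. by rewrite eval_FLin big_ord0. Qed.

Lemma eval_FMax_le (V : Type) (n : nat) (phi : 'I_n.+1 -> formula L V) (e : V -> M) c :
  eval_formula (FMax phi) e <= c <-> forall i, eval_formula (phi i) e <= c.
Proof.
pose v := \row_i eval_formula (phi i) e.
have -> : eval_formula (FMax phi) e = \big[Num.max/v 0 ord0]_i v 0 i by [].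
split=> [h i|h].
  by apply: le_trans h; rewrite (bigD1 i)//= mxE le_max lexx.
by apply: (big_ind (fun x => x <= c)) => [|x y xc yc|i _]; rewrite ?ge_max ?xc ?mxE.
Qed.

Lemma eval_FMax_ge (V : Type) (n : nat) (phi : 'I_n.+1 -> formula L V) (e : V -> M) i :
  eval_formula (phi i) e <= eval_formula (FMax phi) e.
Proof. by move: i; apply/eval_FMax_le. Qed.

(** The body is nonnegative, so the sentence vanishes exactly when every inner infimum is at most 0;
    an infimum need not be attained, hence the [eps]. Later arguments use CR only in this form. *)
Lemma models_CR (k l m n : nat) (lambda : 'I_m -> R)
    (phi : 'I_n.+1 -> formula L ('I_k + 'I_l)) :
  satisfies M (CEq (CR_sentence lambda phi) (FZero L void)) <->
  forall (x : 'I_m -> 'I_k -> M) (y : 'I_l -> M) (eps : R), 0 < eps ->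
  exists z : 'I_k -> M, forall i,
    `|eval_formula (phi i) (join_env z y)
      - \sum_j lambda j * eval_formula (phi i) (join_env (x j) y)| <= eps.
Proof.
rewrite /= /eval_sentence eval_FZero /CR_sentence.
set body := FMax _.
pose xy (x : 'I_m -> 'I_k -> M) (y : 'I_l -> M) :=
  join_env (@of_void M) (join_env (fun jp : 'I_m * 'I_k => x jp.1 jp.2) y).
have bodyE x y z c : eval_formula body (join_env (xy x y) z) <= c <->
    forall i, `|eval_formula (phi i) (join_env z y)
      - \sum_j lambda j * eval_formula (phi i) (join_env (x j) y)| <= c.
  rewrite eval_FMax_le; split=> h i; have := h i;
    rewrite eval_FAbs eval_FSub eval_FLin eval_rename;
    congr (`|_ - _| <= c).
  - by congr eval_formula; apply: funext => -[].
  - apply: eq_bigr => j _; rewrite eval_rename; congr (_ * eval_formula _ _).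
    by apply: funext => -[].
  - by congr eval_formula; apply: funext => -[].
  - apply: eq_bigr => j _; rewrite eval_rename; congr (_ * eval_formula _ _).
    by apply: funext => -[].
have body0 (e : void + ('I_m * 'I_k + 'I_l) + 'I_k -> M) : 0 <= eval_formula body e.
  by apply: le_trans (eval_FMax_ge _ _ ord0); rewrite eval_FAbs normr_ge0.
split=> [h x y eps eps0|h].
  have inf0 : eval_formula (FInfs body) (xy x y) <= 0.
    by apply: (iffLR (eval_FSups_le _ _ _)); rewrite h.
  apply: contrapT => no_z; suff : eps <= 0 by rewrite leNgt eps0.
  apply: le_trans inf0; apply/eval_FInfs_ge => z; rewrite leNgt; apply/negP => lt_eps.
  by apply: no_z; exists z; apply/bodyE/ltW.
apply/eqP; rewrite eq_le; apply/andP; split.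
  apply/eval_FSups_le => f; rewrite leNgt; apply/negP => gt0.
  set c := eval_formula _ _ in gt0.
  have c2 : 0 < c / 2 by rewrite divr_gt0.
  have [z /bodyE] := h (fun j p => f (inl (j, p))) (f \o inr) _ c2.
  rewrite (_ : xy _ _ = join_env (@of_void M) f) => [zc|].
    have := iffLR (eval_FInfs_ge _ _ _) (lexx c) z.
    by move=> /le_trans/(_ zc); rewrite leNgt; lra.
  by apply: funext => -[[]|[[j p]|q]].
have f0 : 'I_m * 'I_k + 'I_l -> M by move=> _; exact: point.
apply: le_trans (iffLR (eval_FSups_le _ _ _) (lexx _) f0).
by apply/eval_FInfs_ge => z; exact: body0.
Qed.

End EvalConnectives.

(** * Approximate convexity in models of CR *)

Lemma real_net (R : realType) (B e : R) : 0 < e ->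
  exists (n : nat) (g : 'I_n -> R), forall x, `|x| <= B -> exists k, `|x - g k| <= e.
Proof.
move=> e0; exists (Num.truncn (2 * B / e)).+1, (fun k => - B + e * k%:R) => x xB.
have /ler_normlP[Bx xB'] := xB.
have x0 : 0 <= (x + B) / e by apply: divr_ge0; lra.
have kn : (Num.truncn ((x + B) / e) < (Num.truncn (2 * B / e)).+1)%N.
  by rewrite ltnS; apply: le_truncn; rewrite ler_pM2r ?invr_gt0//; lra.
exists (Ordinal kn) => /=.
have /andP[] := truncn_itv x0; rewrite ler_pdivlMr// ltr_pdivrMr// -natr1 => h1 h2.
by rewrite ler_norml; apply/andP; split; nra.
Qed.

(* Finite-dimensional Hahn-Banach without compactness: [w] points from a point
   of [C] almost nearest to [v] towards [v]. *)
Lemma separation (R : realType) (J : finType) (C : set (J -> R)) (v : J -> R) (B d : R) :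
  0 < d -> 0 <= B -> (forall j, `|v j| <= B) -> (forall u, C u -> forall j, `|u j| <= B) ->
  C !=set0 ->
  (forall u u' t eps, C u -> C u' -> 0 <= t <= 1 -> 0 < eps ->
    exists2 u'', C u'' & forall j, `|u'' j - ((1 - t) * u j + t * u' j)| <= eps) ->
  (forall u, C u -> exists j, d < `|u j - v j|) ->
  exists2 w : J -> R, (forall j, `|w j| <= 2 * B) &
    forall u, C u -> d ^+ 2 / 2 <= \sum_j w j * (v j - u j).
Proof.
move=> d0 B0 vB CB [u0 Cu0] Cconv Cfar.
pose Q u := \sum_j (v j - u j) ^+ 2; pose D := inf (Q @` C).
have Q0 u : 0 <= Q u by apply: sumr_ge0 => j _; exact: sqr_ge0.
have Qlb : has_lbound (Q @` C) by exists 0 => _ [u _ <-].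
have DQ u : C u -> D <= Q u by move=> Cu; apply: ge_inf => //; exists u.
have Qfar u : C u -> d ^+ 2 <= Q u.
  move=> /Cfar[j dj]; rewrite /Q (bigD1 j)//=.
  apply: (@le_trans _ _ ((v j - u j) ^+ 2)); last first.
    by rewrite lerDl sumr_ge0// => i _; exact: sqr_ge0.
  by rewrite -[leRHS]real_normK ?num_real// distrC lerXn2r ?nnegrE// ltW.
pose n : R := #|J|%:R.
have sum_le (F : J -> R) c : (forall j, F j <= c) -> \sum_j F j <= n * c.
  move=> Fc; apply: (@le_trans _ _ (\sum_(j : J) c)); first exact: ler_sum.
  by rewrite sumr_const mulr_natl.
have n0 : 0 <= n by [].
(* [C] is convex only up to closure, so the combination need not lie in [C]. On the box, each
   summand of [Q] is Lipschitz with constant [4 * B], which dictates the precision requested from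
   [Cconv]; the [+ 1] avoids division by zero. *)
have DQconv u u' t : C u -> C u' -> 0 <= t <= 1 ->
    D <= Q (fun j => (1 - t) * u j + t * u' j).
  move=> Cu Cu' t01; set c := (fun j => _).
  have cB j : `|c j| <= B.
    have /ler_normlP[] := CB _ Cu j; have /ler_normlP[] := CB _ Cu' j.
    by move: t01 => /andP[t0 t1] *; rewrite ler_norml /c; apply/andP; split; nra.
  apply/ler_addgt0Pr => e e0.
  have ne : 0 < n * (4 * B) + 1 by rewrite ltr_wpDl// mulr_ge0// mulr_ge0.
  have [|u'' Cu'' u''c] := Cconv u u' t (e / (n * (4 * B) + 1)) Cu Cu' t01.
    exact: divr_gt0.
  apply: (le_trans (DQ _ Cu'')); rewrite -lerBlDl -sumrB.
  apply: (@le_trans _ _ (n * (e / (n * (4 * B) + 1) * (4 * B)))).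
    apply: sum_le => j; rewrite subr_sqr.
    rewrite (le_trans (ler_norm _))// normrM ler_pM//.
      by rewrite (_ : _ - _ = - (u'' j - c j)) ?normrN; [exact: u''c|ring].
    have /ler_normlP[] := CB _ Cu'' j; have /ler_normlP[] := cB j.
    have /ler_normlP[] := vB j => *.
    by rewrite ler_norml; apply/andP; split; lra.
  rewrite (_ : n * _ = (n * (4 * B)) / (n * (4 * B) + 1) * e); last by field; rewrite gt_eqF.
  by apply: ler_piMl; [exact: ltW|rewrite ler_pdivrMr// mul1r lerDl].
pose G := n * (2 * B) ^+ 2.
have G0 : 0 <= G by rewrite mulr_ge0// sqr_ge0.
have d20 : 0 < d ^+ 2 by rewrite exprn_gt0.
(* Moving from a near-minimiser [u] towards [u'] by [t] changes [Q] by [- 2 * t * X + t ^+ 2 * Y].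
   This [t] keeps the quadratic term below [t * (d ^+ 2 / 2)], and [u] is minimal up to the same
   amount. Hence [X <= d ^+ 2 / 2], while [Q u >= d ^+ 2]. *)
pose t := d ^+ 2 / (2 * (G + d ^+ 2)).
have den0 : 0 < 2 * (G + d ^+ 2) by nra.
have t0 : 0 < t by rewrite divr_gt0.
have t1 : t <= 1 by rewrite ler_pdivrMr// mul1r; lra.
have tG : t * G <= d ^+ 2 / 2.
  rewrite /t mulrAC ler_pdivrMr//; nra.
have [||_ [u Cu <-] QuD] := @inf_adherent _ (Q @` C) (t * (d ^+ 2 / 2)).
- by rewrite mulr_gt0// divr_gt0.
- by split=> //; exists (Q u0), u0.
exists (fun j => v j - u j) => [j|u' Cu'].
  have /ler_normlP[] := CB _ Cu j; have /ler_normlP[] := vB j => *.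
  by rewrite ler_norml; apply/andP; split; lra.
have := DQconv u u' t Cu Cu' _; rewrite ltW// t1 => /(_ isT).
pose X := \sum_j (v j - u j) * (u' j - u j).
pose Y := \sum_j (u' j - u j) ^+ 2.
have -> : Q (fun j => (1 - t) * u j + t * u' j) = Q u - 2 * t * X + t ^+ 2 * Y.
  rewrite /Q /X /Y !mulr_sumr -sumrB -big_split /=.
  by apply: eq_bigr => j _; ring.
have -> : \sum_j (v j - u j) * (v j - u' j) = Q u - X.
  by rewrite -sumrB; apply: eq_bigr => j _; ring.
have YG : Y <= G.
  apply: sum_le => j; rewrite -real_normK ?num_real// lerXn2r ?nnegrE// ?mulr_ge0//.
  have /ler_normlP[] := CB _ Cu j; have /ler_normlP[] := CB _ Cu' j => *.
  by rewrite ler_norml; apply/andP; split; lra.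
have := Qfar u Cu; rewrite -/D in QuD; move=> Qud DQc.
suff : 2 * t * X <= 2 * t * (d ^+ 2 / 2) by rewrite ler_pM2l; lra.
have : t * (t * Y) <= t * (d ^+ 2 / 2).
  by rewrite ler_pM2l// (le_trans _ tG)// ler_pM2l.
by rewrite mulrA -expr2 => tY; lra.
Qed.

Section FiniteCombinations.
Context {R : realType} {L : signature R} {J : finType} {V : Type}.
Implicit Types (psi : J -> formula L V) (w : J -> R).

Definition FComb w psi : formula L V :=
  FLin (fun i : 'I_#|J| => w (enum_val i)) (fun i => psi (enum_val i)).

Lemma eval_FComb w psi (M : structure L) (e : V -> M) :
  eval_formula (FComb w psi) e = \sum_j w j * eval_formula (psi j) e.
Proof.
by rewrite eval_FLin [RHS](reindex _ (onW_bij _ (enum_val_bij J))).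
Qed.

Lemma affine_FComb w psi : (forall j, affine (psi j)) -> affine (FComb w psi).
Proof.
move=> psi_aff; split=> // ; exists 0, (fun i : 'I_#|J| => w (enum_val i)) => v.
by rewrite add0r.
Qed.

Lemma formulas_bounded psi :
  exists2 B, 0 <= B & forall j (M : structure L) (e : V -> M),
    `|eval_formula (psi j) e| <= B.
Proof.
have /choice[B HB] j : exists B, forall (M : structure L) (e : V -> M),
  `|eval_formula (psi j) e| <= B by have [B _ HB] := formula_bounded (psi j); exists B.
exists (\sum_j `|B j|) => [|j M e]; first by apply: sumr_ge0.
rewrite (le_trans (HB _ _ _))// (bigD1 j)//= (le_trans (ler_norm _))//.
by rewrite lerDl sumr_ge0.
Qed.

End FiniteCombinations.

(** Turns the parameters occurring in a formula into an ['I_l]-indexed tuple, as CR requires. The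
    empty list takes [l = 1], since [r] must send all of [V] somewhere. *)
Lemma finite_factor (X : pointedType) (V : Type) (a : V -> X) (S : seq V) :
  exists (l : nat) (r : V -> 'I_l) (b : 'I_l -> X), forall v, List.In v S -> b (r v) = a v.
Proof.
elim: S => [|w S [l [r [b rb]]]]; first by exists 1%N, (fun=> ord0), (fun=> point).
pose r' v := if pselect (v = w) then ord0 else lift ord0 (r v).
exists l.+1, r', (fun i => if unlift ord0 i is Some j then b j else a w) => v vS.
rewrite /r'; case: pselect => [vw|vw] /=; first by rewrite unlift_none vw.
by rewrite liftK; case: vS => [/esym//|]; exact: rb.
Qed.

(** CR for a single variable and two points of weights [1 - t] and [t], with the parameters reduced
    to a finite tuple through the supports. *)
Lemma CR_combination (R : realType) (L : signature R) (J : finType) (V : Type)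
    (psi : J -> formula L (option V)) (psi_aff : forall j, affine (psi j))
    (M : structure L) (hM : models M (CR L)) (a : V -> M) (x0 x1 : M) (t eps : R) :
  0 <= t <= 1 -> 0 < eps ->
  exists z, forall j, `|eval_formula (psi j) (oapp a z)
    - ((1 - t) * eval_formula (psi j) (oapp a x0)
       + t * eval_formula (psi j) (oapp a x1))| <= eps.
Proof.
move=> /andP[t0 t1] eps0.
have /choice[S HS] j := formula_support (psi j).
have [S1 SS1] := support_big (fun i : 'I_#|J| => S (enum_val i)).
have [S2 SS2] := support_option S1.
have [l [r [b rb]]] := finite_factor a S2.
pose r' (v : option V) : 'I_1 + 'I_l := if v is Some v then inr (r v) else inl ord0.
(* CR asks for a nonempty family: slot 0 holds the zero formula, so that [J] may be empty. *)
pose phi (i : 'I_#|J|.+1) : formula L ('I_1 + 'I_l) :=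
  if unlift ord0 i is Some i' then rename r' (psi (enum_val i')) else FZero L _.
have phiE i (x : 'I_1 -> M) : eval_formula (phi (lift ord0 i)) (join_env x b) =
    eval_formula (psi (enum_val i)) (oapp a (x ord0)).
  rewrite /phi liftK eval_rename; apply: HS => -[v|] //= vS.
  by apply: rb; apply: SS2; exact: SS1 vS.
pose lambda (j : 'I_2) : R := if j == ord0 then 1 - t else t.
have : CR L (CEq (CR_sentence lambda phi) (FZero L void)).
  exists 1%N, l, 2%N, #|J|, lambda, phi; split=> //.
  - by move=> j; rewrite /lambda; case: ifP => _ //; rewrite subr_ge0.
  - by rewrite !big_ord_recl big_ord0 /lambda /= addr0 subrK.
  - move=> i; rewrite /phi; case: unliftP => [i'|] _; first exact: affine_rename.
    by split=> [|[]//]; exists 0, (fun=> 0) => v; rewrite add0r.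
move=> /hM/models_CR/(_ (fun j _ => if j == ord0 then x0 else x1) b _ eps0)[z Hz].
exists (z ord0) => j; have := Hz (lift ord0 (enum_rank j)).
by rewrite !big_ord_recl big_ord0 !phiE enum_rankK /lambda /= addr0.
Qed.

(** * Formulas are determined by affine formulas *)

(** If no [y] worked, the value vector at [x] would be separated from the nearly convex set of
    values over [b] by some [w]. Rounding [w] to a grid leaves finitely many suprema [theta], one of
    which already tells [a] from [b]. Only the structure in which [y] is sought must satisfy CR. *)
Lemma realize_close (R : realType) (L : signature R) (J : finType) (V : Type)
    (psi : J -> formula L (option V)) (d : R) :
  (forall j, affine (psi j)) -> 0 < d ->
  exists (K : finType) (theta : K -> formula L V) (d' : R),
    [/\ 0 < d', forall k, affine (theta k) &
      forall (M N : structure L) (a : V -> M) (b : V -> N), models N (CR L) ->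
      (forall k, `|eval_formula (theta k) a - eval_formula (theta k) b| <= d') ->
      forall x, exists y, forall j,
        `|eval_formula (psi j) (oapp a x) - eval_formula (psi j) (oapp b y)| <= d].
Proof.
move=> psi_aff d0; have [B B0 psiB] := formulas_bounded psi.
have d20 : 0 < d ^+ 2 by rewrite exprn_gt0.
pose n : R := #|J|%:R; have n0 : 0 <= n by [].
have nB0 : 0 <= n * (2 * B) by rewrite mulr_ge0// mulr_ge0.
(* Separation yields a gap [d ^+ 2 / 2]. Rounding [w] to within [e] costs at most half of it, and
   the remaining [d ^+ 2 / 4] exceeds the tolerance [d ^+ 2 / 8] chosen below. *)
pose e := d ^+ 2 / 4 / (n * (2 * B) + 1).
have e0 : 0 < e by rewrite divr_gt0//; lra.
have eB : n * (e * (2 * B)) <= d ^+ 2 / 4.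
  by rewrite mulrCA /e mulrAC ler_pdivrMr; nra.
have [K [g Kg]] := real_net (2 * B) e0.
pose theta (k : {ffun J -> 'I_K}) := FSup (FComb (fun j => g (k j)) psi).
exists {ffun J -> 'I_K}, theta, (d ^+ 2 / 8); split=> [|k|M N a b hN ab x]; first by lra.
  exact: (affine_FComb _ psi_aff).
apply: contrapT => no_y.
pose v j := eval_formula (psi j) (oapp a x).
pose C := range (fun y j => eval_formula (psi j) (oapp b y)).
have CB u : C u -> forall j, `|u j| <= B by move=> [y _ <-] j; exact: psiB.
have vB j : `|v j| <= B by exact: psiB.
have [|||w wB Cw] := separation d0 B0 vB CB.
- by exists (fun j => eval_formula (psi j) (oapp b point)), point.
- move=> _ _ t eps [y _ <-] [y' _ <-] t01 eps0.
  have [z Hz] := CR_combination psi_aff hN b y y' t01 eps0.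
  by exists (fun j => eval_formula (psi j) (oapp b z)); first by exists z.
- move=> _ [y _ <-]; apply: contrapT => near_y; apply: no_y; exists y => j.
  rewrite leNgt; apply/negP => dj; apply: near_y; exists j; rewrite distrC.
  exact: dj.
have /choice[k Hk] j := Kg _ (wB j).
pose kk := [ffun j => k j].
have vale (P : structure L) (c : option V -> P) :
    eval_formula (FComb (fun j => g (kk j)) psi) c =
    \sum_j g (k j) * eval_formula (psi j) c.
  by rewrite eval_FComb; under eq_bigr do rewrite ffunE.
pose s := \sum_j g (k j) * v j.
have ha : s <= eval_formula (theta kk) a.
  have := iffLR (eval_FSup_le _ _ _) (lexx (eval_formula (theta kk) a)) x.
  by rewrite vale.
have hb : eval_formula (theta kk) b <= s - d ^+ 2 / 4.
  apply/eval_FSup_le => y; rewrite vale.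
  pose u j := eval_formula (psi j) (oapp b y).
  have Cu : C u by exists y.
  have wu := Cw u Cu.
  have : \sum_j (w j - g (k j)) * (v j - u j) <= n * (e * (2 * B)).
    apply: (@le_trans _ _ (\sum_(j : J) e * (2 * B))); last first.
      by rewrite sumr_const -[_ *+ _]mulr_natl.
    apply: ler_sum => j _; rewrite (le_trans (ler_norm _))// normrM ler_pM//.
    by apply: (le_trans (ler_normB _ _)); have := vB j; have := CB u Cu j; lra.
  rewrite (_ : \sum_j _ = \sum_j w j * (v j - u j) - (s - \sum_j g (k j) * u j)).
    by lra.
  by rewrite /s -!sumrB; apply: eq_bigr => j _; ring.
have /ler_normlP[_] := ab kk; lra.
Qed.

Section Determined.
Context {R : realType} {L : signature R}.

(** Uniform continuity of [phi] in affine data. Comparing two different structures, rather than two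
    tuples of one, is what makes the estimate apply to types and to complete theories. *)
Definition affinely_determined (V : Type) (phi : formula L V) :=
  forall eps : R, 0 < eps ->
  exists (J : finType) (psi : J -> formula L V) (d : R),
    [/\ 0 < d, forall j, affine (psi j) &
      forall (M N : structure L) (a : V -> M) (b : V -> N),
      models M (CR L) -> models N (CR L) ->
      (forall j, `|eval_formula (psi j) a - eval_formula (psi j) b| <= d) ->
      `|eval_formula phi a - eval_formula phi b| <= eps].

Lemma affine_determined (V : Type) (phi : formula L V) :
  affine phi -> affinely_determined phi.
Proof.
move=> phi_aff eps eps0; exists 'I_1, (fun=> phi), eps; split=> // M N a b _ _.
by move/(_ ord0).
Qed.

(** A back-and-forth step: affine agreement of the parameters gives each [x] a partner [y] at which
    [phi] takes nearly the same value. *)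
Lemma quantified_determined (V : Type) (phi : formula L (option V)) :
  affinely_determined phi ->
  affinely_determined (FSup phi) /\ affinely_determined (FInf phi).
Proof.
move=> phi_det.
(* The hypotheses are symmetric in the two structures, so one-sided inequalities suffice; both use
   partners of points of [M]. *)
suff key eps : 0 < eps -> exists (J : finType) (psi : J -> formula L V) (d : R),
    [/\ 0 < d, forall j, affine (psi j) &
      forall (M N : structure L) (a : V -> M) (b : V -> N),
      models M (CR L) -> models N (CR L) ->
      (forall j, `|eval_formula (psi j) a - eval_formula (psi j) b| <= d) ->
      eval_formula (FSup phi) a <= eval_formula (FSup phi) b + eps /\
      eval_formula (FInf phi) b - eps <= eval_formula (FInf phi) a].
  split=> eps eps0; have [J [psi [d [d0 psi_aff H]]]] := key _ eps0;
    exists J, psi, d; split=> // M N a b hM hN ab;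
    have [ab1 ab2] := H _ _ _ _ hM hN ab;
    have [|ba1 ba2] := H _ _ b a hN hM; try by [move=> j; rewrite distrC];
    by rewrite ler_norml; apply/andP; split; lra.
move=> eps0; have [J [psi [d [d0 psi_aff H]]]] := phi_det _ eps0.
have [K [theta [d' [d'0 theta_aff H']]]] := realize_close psi_aff d0.
exists K, theta, d'; split=> // M N a b hM hN ab.
have close x : exists y,
    `|eval_formula phi (oapp a x) - eval_formula phi (oapp b y)| <= eps.
  by have [y Hy] := H' _ _ _ _ hN ab x; exists y; exact: H.
split.
  apply/eval_FSup_le => x; have [y /ler_normlP[_ xy]] := close x.
  have := iffLR (eval_FSup_le _ _ _) (lexx (eval_formula (FSup phi) b)) y; lra.
apply/eval_FInf_ge => x; have [y /ler_normlP[xy _]] := close x.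
have := iffLR (eval_FInf_ge _ _ _) (lexx (eval_formula (FInf phi) b)) y; lra.
Qed.

Lemma all_determined (V : Type) (phi : formula L V) : affinely_determined phi.
Proof.
elim: phi => {V} [V P ts|V t1 t2|V n u phis IH|V phi IH|V phi IH].
- exact: affine_determined.
- exact: affine_determined.
- move=> eps eps0; have [B B0 HB] := formulas_bounded phis.
  have [e e0 ue] := @box_unif_continuous R n u B eps (@cts_fun _ _ u) eps0.
  have /choice[F /choice[d H]] i : exists (F : {J : finType & J -> formula L V}) (d : R),
      [/\ 0 < d, forall j, affine (tagged F j) &
        forall (M N : structure L) (a : V -> M) (b : V -> N),
        models M (CR L) -> models N (CR L) ->
        (forall j, `|eval_formula (tagged F j) a - eval_formula (tagged F j) b| <= d) ->
        `|eval_formula (phis i) a - eval_formula (phis i) b| <= e].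
    have [J [psi [d H]]] := IH i e e0.
    by exists (existT (fun J : finType => J -> formula L V) J psi), d.
  pose J i := tag (F i); pose psi i := tagged (F i) : J i -> formula L V.
  (* The families of all the arguments are pooled; the default [1] keeps the tolerance positive when
     [n = 0]. *)
  exists {i : 'I_n & J i}, (fun s => psi (tag s) (tagged s)),
    (\big[Num.min/1]_i d i); split=> [|s|M N a b hM hN ab].
  + apply: (big_ind (fun x => 0 < x)) => [//|x y x0 y0|i _]; first by rewrite lt_min x0.
    by case: (H i).
  + by case: (H (tag s)) => _ Fs _; exact: Fs.
  + apply: ue => i; rewrite !mxE; first exact: HB.
    have [_ _ Hi] := H i; apply: Hi => // j.
    apply: (le_trans (ab (Tagged J j))).
    by rewrite (bigD1 i)//= ge_min lexx.
- by have [] := quantified_determined IH.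
- by have [] := quantified_determined IH.
Qed.

End Determined.

(** * Delta-convex reduction *)

Section DeltaConvex.
Context {R : realType} {L : signature R} {V : Type}.
Implicit Types (g : forall M : structure L, (V -> M) -> R).

Lemma conn_affine_continuous (w c : R) :
  continuous (fun v : 'rV[R]_1 => w * v 0 0 + c).
Proof.
move=> v; apply: (@continuousD R R^o _ (fun v : 'rV[R]_1 => w * v 0 0) (cst c)).
  apply: (@continuousM R _ (cst w)); first exact: cst_continuous.
  exact: conn_coord_continuous.
exact: cst_continuous.
Qed.

Definition FAffine (w c : R) (phi : formula L V) : formula L V :=
  FConn (mkcts (@conn_affine_continuous w c)) (fun=> phi).

Lemma eval_FAffine w c phi (M : structure L) (e : V -> M) :
  eval_formula (FAffine w c phi) e = w * eval_formula phi e + c.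
Proof. by rewrite /=; congr (_ * _ + _); rewrite mxE. Qed.

Lemma affine_FAffine w c phi : affine phi -> affine (FAffine w c phi).
Proof.
split=> //; exists c, (fun=> w) => v /=.
by rewrite big_ord_recl big_ord0 addr0 addrC.
Qed.

(* The maximum of the [psi i] is encoded by its universal property; [i0] only
   makes the family nonempty. *)
Definition max_affine g := exists (I : finType) (i0 : I) (psi : I -> formula L V),
  (forall i, affine (psi i)) /\
  forall (M : structure L) (e : V -> M) c,
    g M e <= c <-> forall i, eval_formula (psi i) e <= c.

Lemma max_affineP (I : finType) (i0 : I) (psi : I -> formula L V) :
  (forall i, affine (psi i)) ->
  exists g, max_affine g /\ forall (M : structure L) (e : V -> M) c,
    g M e <= c <-> forall i, eval_formula (psi i) e <= c.
Proof.
move=> psi_aff.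
exists (fun M e => \big[Num.max/eval_formula (psi i0) e]_i eval_formula (psi i) e).
suff H (M : structure L) (e : V -> M) c :
    \big[Num.max/eval_formula (psi i0) e]_i eval_formula (psi i) e <= c <->
    forall i, eval_formula (psi i) e <= c by split=> //; exists I, i0, psi.
split=> [/bigmax_leP[_ h] i|h]; first exact: h.
by apply/bigmax_leP; split=> // i _.
Qed.

Lemma max_affine_FMax g : max_affine g ->
  exists (n : nat) (psi : 'I_n.+1 -> formula L V), (forall i, affine (psi i)) /\
  forall (M : structure L) (e : V -> M), eval_formula (FMax psi) e = g M e.
Proof.
move=> [I [i0 [psi [psi_aff Hg]]]].
have cardI : #|I|.-1.+1 = #|I| by rewrite prednK//; apply/card_gt0P; exists i0.
exists #|I|.-1, (fun i => psi (enum_val (cast_ord cardI i))); split=> // M e.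
have le_iff c : eval_formula (FMax (fun i => psi (enum_val (cast_ord cardI i)))) e <= c
    <-> g M e <= c.
  rewrite eval_FMax_le Hg; split=> h i; last exact: h.
  by have := h (cast_ord (esym cardI) (enum_rank i)); rewrite cast_ordKV enum_rankK.
by apply/eqP; rewrite eq_le; apply/andP; split; apply/le_iff.
Qed.

(** A sum of maxima is the maximum, over pairs of indices, of the sums. *)
Lemma max_affineD g1 g2 : max_affine g1 -> max_affine g2 ->
  max_affine (fun M e => g1 M e + g2 M e).
Proof.
move=> [I [i0 [psi [psi_aff H1]]]] [J [j0 [chi [chi_aff H2]]]].
exists (I * J)%type, (i0, j0),
  (fun p => FComb (fun=> 1) (fun b : bool => if b then psi p.1 else chi p.2)).
split=> [p|M e c]; first by apply: affine_FComb => -[].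
split=> [h [i j]|h].
  rewrite eval_FComb big_bool /= !mul1r; apply: le_trans h.
  by apply: lerD; [move: i; apply/H1|move: j; apply/H2].
rewrite -lerBrDr; apply/H1 => i; rewrite lerBrDr -lerBrDl; apply/H2 => j.
by rewrite lerBrDl; have := h (i, j); rewrite eval_FComb big_bool /= !mul1r.
Qed.

Lemma max_affine_max g1 g2 : max_affine g1 -> max_affine g2 ->
  max_affine (fun M e => Num.max (g1 M e) (g2 M e)).
Proof.
move=> [I [i0 [psi [psi_aff H1]]]] [J [j0 [chi [chi_aff H2]]]].
exists (I + J)%type, (inl i0), (fun s => match s with inl i => psi i | inr j => chi j end).
split=> [[]//|M e c]; rewrite ge_max; split=> [/andP[h1 h2] [i|j]|h].
- by move: i; apply/H1.
- by move: j; apply/H2.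
- by apply/andP; split; [apply/H1 => i; exact: h (inl i)|apply/H2 => j; exact: h (inr j)].
Qed.

Definition max_affine_diff g := exists g1 g2, [/\ max_affine g1, max_affine g2 &
  forall (M : structure L) (e : V -> M), g M e = g1 M e - g2 M e].

Lemma max_affine_const c : max_affine (fun _ _ => c).
Proof.
exists unit, tt, (fun=> FAffine 0 c (FZero L V)); split=> [_|M e c'].
  by apply: affine_FAffine; split=> [|[]//]; exists 0, (fun=> 0) => v; rewrite add0r.
by split=> [h _|/(_ tt)]; rewrite eval_FAffine mul0r add0r.
Qed.

Lemma max_affine_diffW g : max_affine g -> max_affine_diff g.
Proof.
move=> hg; exists g, (fun _ _ => 0); split=> //; first exact: max_affine_const.
by move=> M e; rewrite subr0.
Qed.

(** Rests on [min (g1 - g2) (h1 - h2) = (g1 + h1) - max (g2 + h1) (g1 + h2)]. *)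
Lemma max_affine_diff_min g h : max_affine_diff g -> max_affine_diff h ->
  max_affine_diff (fun M e => Num.min (g M e) (h M e)).
Proof.
move=> [g1 [g2 [hg1 hg2 gE]]] [h1 [h2 [hh1 hh2 hE]]].
exists (fun M e => g1 M e + h1 M e),
  (fun M e => Num.max (g2 M e + h1 M e) (g1 M e + h2 M e)).
split; [exact: max_affineD|by apply: max_affine_max; exact: max_affineD|].
move=> M e; rewrite gE hE.
by case: (lerP (g1 M e - g2 M e) (h1 M e - h2 M e)) => ?;
  case: (lerP (g2 M e + h1 M e) (g1 M e + h2 M e)) => ?; lra.
Qed.

Lemma max_affine_diff_bigmin (I : Type) (r : seq I)
    (F : I -> forall M : structure L, (V -> M) -> R) c :
  (forall i, max_affine_diff (F i)) ->
  max_affine_diff (fun M e => \big[Num.min/c]_(i <- r) F i M e).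
Proof.
move=> HF; elim: r => [|i r IH].
  have [g1 [g2 [h1 h2 gE]]] := max_affine_diffW (max_affine_const c).
  by exists g1, g2; split=> // M e; rewrite big_nil -gE.
have [g1 [g2 [h1 h2 gE]]] := max_affine_diff_min (HF i) IH.
by exists g1, g2; split=> // M e; rewrite big_cons -gE.
Qed.

Lemma max_affine_diff_delta_convex g : max_affine_diff g ->
  exists2 psi, delta_convex psi &
    forall (M : structure L) (e : V -> M), eval_formula psi e = g M e.
Proof.
move=> [g1 [g2 [/max_affine_FMax[m [psi [psi_aff Hpsi]]]
  /max_affine_FMax[n [chi [chi_aff Hchi]]] gE]]].
exists (FSub (FMax psi) (FMax chi)); first by exists m, n, psi, chi.
by move=> M e; rewrite eval_FSub Hpsi Hchi gE.
Qed.

(* [phi] is approximated by the lower envelope of the cones of slope [K]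
   centred at a finite net of the realised values of the formulas determining it. *)
Lemma delta_convex_approx (phi : formula L V) (eps : R) : 0 < eps ->
  exists2 psi, delta_convex psi & forall (M : structure L), models M (CR L) ->
    forall a : V -> M, `|eval_formula phi a - eval_formula psi a| <= eps.
Proof.
move=> eps0; have eps2 : 0 < eps / 2 by lra.
have [J [psi [d [d0 psi_aff H]]]] := all_determined phi eps2.
have [B' B'0 phiB] := formula_bounded phi.
have [B B0 psiB] := formulas_bounded psi.
(* With this slope a cone rises by [2 * B'], the full width of the range of [phi], once some [psi j]
   is at distance [d] from its centre. *)
pose K := 2 * B' / d.
have K0 : 0 <= K by rewrite divr_ge0 ?mulr_ge0// ltW.
have Kd : K * d = 2 * B' by rewrite mulfVK// gt_eqF.
(* Two realisations in the same cell differ by at most [2 * eta] in each coordinate. The first bound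
   puts them within [d], so that [H] applies; the second makes the cone rise by at most [eps / 2]
   inside the cell. [K + 1] is used because [K] may be 0. *)
pose eta := Num.min (d / 2) (eps / 4 / (K + 1)).
have K1 : 0 < K + 1 by lra.
have eta0 : 0 < eta by rewrite lt_min !divr_gt0.
have eta_d : 2 * eta <= d.
  have : eta <= d / 2 by rewrite ge_min lexx.
  lra.
have eta_eps : K * (2 * eta) <= eps / 2.
  have : eta <= eps / 4 / (K + 1) by rewrite ge_min lexx orbT.
  rewrite ler_pdivlMr// => eta_le.
  nra.
have [n [g Hg]] := real_net B eta0.
(* A cell realised in some model of CR takes one of its realisations as centre. An empty cell gets
   height [B'], above every value of [phi], so it cannot spoil the lower envelope. *)
have /choice[cp Hcp] (k : {ffun J -> 'I_n}) : exists cp : R * (J -> R),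
    (exists (M : structure L) (b : V -> M), [/\ models M (CR L),
       forall j, `|eval_formula (psi j) b - g (k j)| <= eta &
       cp = (eval_formula phi b, fun j => eval_formula (psi j) b)]) \/
    cp.1 = B' /\ forall (M : structure L) (b : V -> M), models M (CR L) ->
       ~ forall j, `|eval_formula (psi j) b - g (k j)| <= eta.
  have [[M [b [hM Hb]]]|no] := pselect (exists (M : structure L) (b : V -> M),
      models M (CR L) /\ forall j, `|eval_formula (psi j) b - g (k j)| <= eta).
    exists (eval_formula phi b, fun j => eval_formula (psi j) b).
    by left; exists M, b.
  exists (B', fun=> 0); right; split=> // M b hM Hb.
  by apply: no; exists M, b.
(* The two signs encode the absolute value as a maximum of affine formulas; [None] supplies the apex
   height and keeps the index set nonempty when [J] is empty. *)
pose cone k (s : option (J * bool)) : formula L V :=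
  match s with
  | None => FAffine 0 (cp k).1 (FZero L V)
  | Some (j, b) => FAffine ((-1) ^+ b * K) ((cp k).1 - (-1) ^+ b * K * (cp k).2 j) (psi j)
  end.
have cone_aff k s : affine (cone k s).
  case: s => [[j b]|]; apply: affine_FAffine => //.
  by split=> [|[]//]; exists 0, (fun=> 0) => v; rewrite add0r.
have /choice[G HG] k := max_affineP None (cone_aff k).
have G_le k (M : structure L) (e : V -> M) r : G k M e <= r <->
    (cp k).1 <= r /\ forall j, (cp k).1 + K * `|eval_formula (psi j) e - (cp k).2 j| <= r.
  rewrite (proj2 (HG k)); split=> [h|[h0 h] [[j b]|]].
  - split=> [|j]; first by have := h None; rewrite eval_FAffine eval_FZero mulr0 add0r.
    have h1 := h (Some (j, false)); have h2 := h (Some (j, true)).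
    rewrite !eval_FAffine ?expr0 ?expr1 in h1 h2.
    by case: (ger0P (eval_formula (psi j) e - (cp k).2 j)) => _; lra.
  - apply: le_trans (h j); rewrite eval_FAffine.
    set x := eval_formula _ _; set p := (cp k).2 j; set q := (cp k).1.
    rewrite (_ : (-1) ^+ b * K * x + (q - (-1) ^+ b * K * p) = q + K * ((-1) ^+ b * (x - p)));
      last by move: ((-1) ^+ b) => sgn; ring.
    rewrite lerD2l ler_wpM2l// -[leRHS](normrMsign b).
    exact: ler_norm.
  - by rewrite eval_FAffine eval_FZero mulr0 add0r.
have [chi dc_chi chiE] := max_affine_diff_delta_convex
  (max_affine_diff_bigmin (index_enum {ffun J -> 'I_n}) B'
    (fun k => max_affine_diffW (proj1 (HG k)))).
exists chi => // M hM a; rewrite chiE distrC.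
(* No cone passes below [phi - eps]: near its centre by determination, far from it because the slope
   has already added [K * d = 2 * B']. *)
have chi_ge : eval_formula phi a - eps <= \big[Num.min/B']_k G k M a.
  apply: le_bigmin => [|k _]; first by have /ler_normlP[] := phiB M a; lra.
  have /G_le[G1 G2] := lexx (G k M a).
  have [[N [b [hN Hb cpE]]]|[cpE _]] := Hcp k; last first.
    by have /ler_normlP[_] := phiB M a; rewrite cpE in G1; lra.
  rewrite cpE /= in G1 G2.
  have [near_b|/existsNP[j /negP]] := pselect (forall j,
      `|eval_formula (psi j) a - eval_formula (psi j) b| <= d).
    by have /ler_normlP[_] := H _ _ _ _ hM hN near_b; lra.
  rewrite -ltNge => far_b.
  have /ler_normlP[_ h1] := phiB M a; have /ler_normlP[h2 _] := phiB N b.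
  have : K * d <= K * `|eval_formula (psi j) a - eval_formula (psi j) b|.
    by rewrite ler_wpM2l// ltW.
  by have := G2 j; lra.
(* The cone of the cell containing [a] is low enough at [a]; that cell is not empty, being realised
   by [a] itself. *)
have chi_le : \big[Num.min/B']_k G k M a <= eval_formula phi a + eps.
  have /choice[k Hk] j := Hg _ (psiB j M a).
  pose kk := [ffun j => k j].
  have Hkk j : `|eval_formula (psi j) a - g (kk j)| <= eta by rewrite ffunE.
  apply: (@le_trans _ _ (G kk M a)); first by apply: bigmin_le_cond.
  have [[N [b [hN Hb cpE]]]|[_ /(_ M a hM)//]] := Hcp kk.
  have near_b j : `|eval_formula (psi j) a - eval_formula (psi j) b| <= 2 * eta.
    rewrite (_ : _ - _ = (eval_formula (psi j) a - g (kk j)) -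
      (eval_formula (psi j) b - g (kk j))); last by ring.
    by apply: (le_trans (ler_normB _ _)); have := Hkk j; have := Hb j; lra.
  have /ler_normlP[h1 h2] : `|eval_formula phi a - eval_formula phi b| <= eps / 2.
    by apply: H => // j; exact: le_trans (near_b j) eta_d.
  apply/G_le; rewrite cpE /=; split=> [|j]; first by lra.
  have : K * `|eval_formula (psi j) a - eval_formula (psi j) b| <= K * (2 * eta).
    by rewrite ler_wpM2l.
  by lra.
by rewrite ler_norml; apply/andP; split; lra.
Qed.

End DeltaConvex.

(** * The ultraproduct of the finite powers of a structure *)

Lemma nonprincipal_ultrafilter :
  exists U : set_system nat, UltraFilter U /\ \oo `<=` U.
Proof. exact: ultraFilterLemma. Qed.

Definition ultra : set_system nat := sval (cid nonprincipal_ultrafilter).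

Instance ultra_UltraFilter : UltraFilter ultra.
Proof. exact: (svalP (cid nonprincipal_ultrafilter)).1. Qed.

Instance ultra_ProperFilter : ProperFilter ultra.
Proof. exact: ultra_proper. Qed.

Lemma ultra_eventually : \oo `<=` ultra.
Proof. by case: (svalP (cid nonprincipal_ultrafilter)). Qed.

(** * Averages and their limits along the ultrafilter *)

Section Mean.
Context {R : realType}.
Implicit Types (F G : nat -> nat -> R).

Definition average F (n : nat) : R := (\sum_(i < n.+1) F n i) / n.+1%:R.

(* The mean of [F] over the ultraproduct of the uniform probability spaces
   [{0, ..., n}]: row [n] only matters up to column [n]. *)
Definition mean F : R := lim (average F @ ultra).

Definition bounded2 F := exists B, forall n i, `|F n i| <= B.

Lemma average_le F G n : (forall i, F n i <= G n i) -> average F n <= average G n.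
Proof. by move=> FG; rewrite ler_pM2r ?invr_gt0// ler_sum. Qed.

Lemma averageD F G n : average (fun n i => F n i + G n i) n = average F n + average G n.
Proof. by rewrite /average big_split mulrDl. Qed.

Lemma averageZ c F n : average (fun n i => c * F n i) n = c * average F n.
Proof. by rewrite /average -mulr_sumr mulrA. Qed.

Lemma average_cst c n : average (fun _ _ => c) n = c.
Proof. by rewrite /average sumr_const card_ord -[c *+ _]mulr_natr mulfK// pnatr_eq0. Qed.

(** Compactness of the segment gives a cluster point, and an ultrafilter converges to its cluster
    points. The boundedness hypotheses below serve to ensure that [mean] is a genuine limit. *)
Lemma mean_cvg F : bounded2 F -> average F @ ultra --> mean F.
Proof.
move=> [B FB].
have avgB n : `[- B, B]%classic (average F n).
  have lo := average_cst (- B) n; have hi := average_cst B n.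
  rewrite /= in_itv /= -{1}lo -{2}hi.
  by apply/andP; split; apply: average_le => i; have := FB n i; rewrite ler_norml => /andP[].
have [p [_ clp]] : `[- B, B]%classic `&` cluster (average F @ ultra) !=set0.
  by apply: (@segment_compact R (- B) B (average F @ ultra) _); exact: nearW.
apply/cvg_ex; exists p => N Np.
have [//|UN] := in_ultra_setVsetC (average F @^-1` N) ultra_UltraFilter.
by have [x [/= Nx]] := clp (~` N) N UN Np.
Qed.

Lemma meanE F l : average F @ ultra --> l -> mean F = l.
Proof. exact: cvg_lim. Qed.

Lemma mean_cst c : mean (fun _ _ => c) = c.
Proof.
apply: meanE; rewrite (_ : average _ = cst c); first exact: cvg_cst.
by apply: funext => n; exact: average_cst.
Qed.

Lemma meanD F G : bounded2 F -> bounded2 G ->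
  mean (fun n i => F n i + G n i) = mean F + mean G.
Proof.
move=> /mean_cvg hF /mean_cvg hG; apply: meanE.
rewrite (_ : average _ = average F \+ average G); first exact: cvgD.
by apply: funext => n; exact: averageD.
Qed.

Lemma meanZ c F : bounded2 F -> mean (fun n i => c * F n i) = c * mean F.
Proof.
move=> /mean_cvg hF; apply: meanE.
rewrite (_ : average _ = cst c \* average F); first by apply: cvgM => //; exact: cvg_cst.
by apply: funext => n; exact: averageZ.
Qed.

Lemma mean_le_near F c : bounded2 F -> (\forall n \near ultra, average F n <= c) ->
  mean F <= c.
Proof. by move=> /mean_cvg hF; exact: cvgr_to_le hF. Qed.

Lemma mean_ge_near F c : bounded2 F -> (\forall n \near ultra, c <= average F n) ->
  c <= mean F.
Proof. by move=> /mean_cvg hF; exact: cvgr_to_ge hF. Qed.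

Lemma mean_lt_near F c : bounded2 F -> mean F < c -> \forall n \near ultra, average F n < c.
Proof. by move=> /mean_cvg hF Fc; exact: (cvgr_lt _ hF). Qed.

Lemma bounded2D F G : bounded2 F -> bounded2 G -> bounded2 (fun n i => F n i + G n i).
Proof.
move=> [B FB] [C GC]; exists (B + C) => n i.
by rewrite (le_trans (ler_normD _ _))// lerD.
Qed.

Lemma bounded2Z c F : bounded2 F -> bounded2 (fun n i => c * F n i).
Proof. by move=> [B FB]; exists (`|c| * B) => n i; rewrite normrM ler_wpM2l. Qed.

Lemma bounded2_cst c : bounded2 (fun _ _ => c).
Proof. by exists `|c|. Qed.

Lemma bounded2_sum n (F : 'I_n -> nat -> nat -> R) :
  (forall j, bounded2 (F j)) -> bounded2 (fun k i => \sum_j F j k i).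
Proof.
move=> /choice[B FB]; exists (\sum_j B j) => k i.
by rewrite (le_trans (ler_norm_sum _ _ _))// ler_sum.
Qed.

Lemma mean_sum n (F : 'I_n -> nat -> nat -> R) : (forall j, bounded2 (F j)) ->
  mean (fun k i => \sum_j F j k i) = \sum_j mean (F j).
Proof.
elim: n F => [|n IH] F Fb.
  rewrite big_ord0 -[RHS](mean_cst 0); congr mean.
  by do 2 apply: funext => ?; rewrite big_ord0.
rewrite big_ord_recl -IH// -meanD//; last exact: bounded2_sum.
by congr mean; do 2 apply: funext => ?; rewrite big_ord_recl.
Qed.

Lemma mean_le F G : bounded2 F -> bounded2 G -> (forall n i, F n i <= G n i) ->
  mean F <= mean G.
Proof.
move=> Fb Gb FG; rewrite -subr_ge0 -mulN1r -meanZ// -meanD//; last exact: bounded2Z.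
apply: mean_ge_near; first by apply: bounded2D => //; exact: bounded2Z.
apply: nearW => n; rewrite averageD averageZ mulN1r subr_ge0.
exact: average_le.
Qed.

Lemma mean_le_cst F c : bounded2 F -> (forall n i, F n i <= c) -> mean F <= c.
Proof. by move=> Fb Fc; rewrite -(mean_cst c); apply: mean_le => //; exact: bounded2_cst. Qed.

Lemma mean_ge_cst F c : bounded2 F -> (forall n i, c <= F n i) -> c <= mean F.
Proof. by move=> Fb Fc; rewrite -(mean_cst c); apply: mean_le => //; exact: bounded2_cst. Qed.

Lemma mean_abs_sub F G : bounded2 F -> bounded2 G ->
  `|mean F - mean G| <= mean (fun n i => `|F n i - G n i|).
Proof.
move=> Fb Gb.
have Hb : bounded2 (fun n i => `|F n i - G n i|).
  have [B HB] := bounded2D Fb (bounded2Z (-1) Gb).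
  by exists B => n i; rewrite normr_id; have := HB n i; rewrite mulN1r.
rewrite ler_norml; apply/andP; split.
  rewrite lerNl opprB lerBlDr -meanD//; apply: mean_le => // [|n i].
    exact: bounded2D.
  by have := ler_norm (- (F n i - G n i)); rewrite normrN; lra.
rewrite lerBlDr -meanD//; apply: mean_le => // [|n i]; first exact: bounded2D.
by have := ler_norm (F n i - G n i); lra.
Qed.

End Mean.

(** * Convex moduli and Jensen's inequality *)

Section Modulus.
Context {R : realType} (D : modulus R).

Lemma modulus_le_conv x y t : 0 <= x -> 0 <= y -> 0 <= t <= 1 ->
  D (t * x + (1 - t) * y) <= t * D x + (1 - t) * D y.
Proof.
move=> x0 y0 /andP[t0 t1].
have xD : x \in `[0, +oo[%classic by rewrite inE /= in_itv /= x0.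
have yD : y \in `[0, +oo[%classic by rewrite inE /= in_itv /= y0.
have := modulus_convex D (Itv01 t0 t1) xD yD; rewrite !convRE /=.
exact.
Qed.

Lemma modulus_ge0 x : 0 <= x -> 0 <= D x.
Proof. by rewrite le_eqVlt => /orP[/eqP<-|/modulus_gt0/ltW//]; rewrite modulus0. Qed.

Lemma modulus_le x y : 0 <= x -> x <= y -> D x <= D y.
Proof.
move=> x0 xy; have [y0|y0] := ltP 0 y; last by rewrite (_ : x = y)//; lra.
have t01 : 0 <= x / y <= 1 by rewrite divr_ge0 ?(ltW y0)//= ler_pdivrMr// mul1r.
have := modulus_le_conv (ltW y0) (lexx 0) t01.
rewrite modulus0 !mulr0 !addr0 divfK ?gt_eqF// => /le_trans; apply.
by apply: ler_piMl; [exact/modulus_ge0/ltW|case/andP: t01].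
Qed.

Lemma modulus_eq0 x : 0 <= x -> D x <= 0 -> x = 0.
Proof.
by rewrite le_eqVlt => /orP[/eqP//|/(modulus_gt0 D)]; rewrite ltNge => /negbTE->.
Qed.

(** The slope is the supremum of the chord slopes to the left of [x], which convexity bounds by
    every chord slope to the right. Positivity of [x] makes left chords available. *)
Lemma modulus_supporting_line x : 0 < x ->
  exists s, forall y, 0 <= y -> D x + s * (y - x) <= D y.
Proof.
move=> x0.
have slopes y z : 0 <= y -> y < x -> x < z ->
    (D x - D y) / (x - y) <= (D z - D x) / (z - x).
  move=> y0 yx xz; rewrite ler_pdivrMr ?subr_gt0// mulrAC ler_pdivlMr ?subr_gt0//.
  have zy : 0 < z - y by lra.
  have t01 : 0 <= (z - x) / (z - y) <= 1.
    by rewrite divr_ge0 ?subr_ge0//= ?ler_pdivrMr// ?mul1r; lra.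
  have z0 : 0 <= z by lra.
  have := modulus_le_conv y0 z0 t01.
  have -> : 1 - (z - x) / (z - y) = (x - y) / (z - y) by field; rewrite gt_eqF.
  have -> : (z - x) / (z - y) * y + (x - y) / (z - y) * z = x by field; rewrite gt_eqF.
  rewrite -(ler_pM2r zy).
  rewrite [leRHS](_ : _ = (z - x) * D y + (x - y) * D z); first by lra.
  by field; rewrite gt_eqF.
pose A := [set r | exists2 y, 0 <= y < x & r = (D x - D y) / (x - y)].
have Aub z : x < z -> ubound A ((D z - D x) / (z - x)).
  by move=> xz _ [y /andP[y0 yx] ->]; exact: slopes.
have A0 : A !=set0 by exists ((D x - D 0) / (x - 0)), 0; rewrite ?lexx.
exists (sup A) => y y0; case: (ltgtP y x) => [yx|xy|->].
- have : (D x - D y) / (x - y) <= sup A.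
    apply: ub_le_sup; last by exists y; rewrite ?y0.
    by exists ((D (x + 1) - D x) / (x + 1 - x)); apply: Aub; lra.
  rewrite ler_pdivrMr ?subr_gt0//; lra.
- have : sup A <= (D y - D x) / (y - x) by apply: ge_sup => //; exact: Aub.
  rewrite ler_pdivlMr ?subr_gt0//; lra.
- lra.
Qed.

(** Average the supporting line at [mean h]; if [mean h] is 0, the left side is [D 0 = 0]. This is
    why averaged interpretations keep the moduli of the signature. *)
Lemma modulus_mean_jensen (h k : nat -> nat -> R) : bounded2 h -> bounded2 k ->
  (forall n i, 0 <= h n i) -> (forall n i, D (h n i) <= k n i) -> D (mean h) <= mean k.
Proof.
move=> hb kb h0 hk.
have : 0 <= mean h by exact: mean_ge_cst.
rewrite le_eqVlt => /orP[/eqP<-|/modulus_supporting_line[s Hs]].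
  rewrite modulus0; apply: mean_ge_cst => // n i.
  exact: le_trans (modulus_ge0 (h0 n i)) (hk n i).
set c := D (mean h) in Hs *.
have -> : c = mean (fun n i => s * h n i + (c - s * mean h)).
  rewrite meanD ?meanZ ?mean_cst//; [by ring|exact: bounded2Z|exact: bounded2_cst].
apply: mean_le => // [|n i].
  by apply: bounded2D; [exact: bounded2Z|exact: bounded2_cst].
by apply: le_trans (hk n i); have := Hs _ (h0 n i); lra.
Qed.

End Modulus.

Local Open Scope quotient_scope.

(** * The ultraproduct as a complete metric space *)

Section PowerUltraproduct.
Context {R : realType} {L : signature R} (M : structure L).
Implicit Types f g h : nat -> nat -> M.

Definition family_dist f g : R := mean (fun n i => mdist (f n i) (g n i)).

Lemma bounded2_mdist f g : bounded2 (fun n i => mdist (f n i) (g n i)).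
Proof.
by exists (diameter L) => n i; rewrite ger0_norm ?mdist_ge0// mdist_diameter.
Qed.

Lemma family_dist_ge0 f g : 0 <= family_dist f g.
Proof.
by apply: mean_ge_cst => [|n i]; [exact: bounded2_mdist|exact: mdist_ge0].
Qed.

Lemma family_distxx f : family_dist f f = 0.
Proof.
rewrite -[RHS](mean_cst 0); congr mean.
by do 2 apply: funext => ?; exact: mdistxx.
Qed.

Lemma family_distC f g : family_dist f g = family_dist g f.
Proof. by congr mean; do 2 apply: funext => ?; exact: metric_sym. Qed.

Lemma family_dist_triangle g f h : family_dist f h <= family_dist f g + family_dist g h.
Proof.
rewrite -meanD; [|exact: bounded2_mdist..].
apply: mean_le => [||n i]; [exact: bounded2_mdist| |exact: metric_triangle].
by apply: bounded2D; exact: bounded2_mdist.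
Qed.

Definition family_equiv f g := family_dist f g == 0.

Lemma family_equiv_refl : reflexive family_equiv.
Proof. by move=> f; rewrite /family_equiv family_distxx. Qed.

Lemma family_equiv_sym : symmetric family_equiv.
Proof. by move=> f g; rewrite /family_equiv family_distC. Qed.

Lemma family_equiv_trans : transitive family_equiv.
Proof.
move=> g f h /eqP fg /eqP gh; rewrite /family_equiv eq_le family_dist_ge0 andbT.
by apply: le_trans (family_dist_triangle g f h) _; rewrite fg gh addr0.
Qed.

Canonical family_equiv_rel :=
  EquivRel family_equiv family_equiv_refl family_equiv_sym family_equiv_trans.

Definition upower := {eq_quot family_equiv}.

HB.instance Definition _ := Choice.on upower.

Definition cls f : upower := \pi f.
Definition rep (x : upower) : nat -> nat -> M := repr x.

Lemma repK x : cls (rep x) = x.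
Proof. exact: reprK. Qed.

Lemma eq_cls f g : family_dist f g = 0 -> cls f = cls g.
Proof. by move=> fg; apply/eqmodP; rewrite /= /family_equiv fg. Qed.

Lemma cls_rep f : family_dist (rep (cls f)) f = 0.
Proof. by have /eqmodP/eqP := repK (cls f). Qed.

Definition upower_dist (x y : upower) : R := family_dist (rep x) (rep y).

Lemma upower_dist_cls f g : upower_dist (cls f) (cls g) = family_dist f g.
Proof.
apply/eqP; rewrite eq_le; apply/andP; split.
  apply: (le_trans (family_dist_triangle f _ _)); rewrite cls_rep add0r.
  apply: (le_trans (family_dist_triangle g _ _)).
  by rewrite (family_distC g) cls_rep addr0.
apply: (le_trans (family_dist_triangle (rep (cls f)) _ _)).
rewrite (family_distC f) cls_rep add0r.
by apply: (le_trans (family_dist_triangle (rep (cls g)) _ _)); rewrite cls_rep addr0.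
Qed.

Lemma upower_distxx x : upower_dist x x = 0.
Proof. exact: family_distxx. Qed.

Lemma upower_dist_positivity x y : upower_dist x y = 0 -> x = y.
Proof. by move=> /eq_cls; rewrite !repK. Qed.

Lemma upower_distC x y : upower_dist x y = upower_dist y x.
Proof. exact: family_distC. Qed.

Lemma upower_dist_triangle y x z : upower_dist x z <= upower_dist x y + upower_dist y z.
Proof. exact: family_dist_triangle. Qed.

HB.instance Definition _ := isMetric.Build R upower
  upower_distxx upower_dist_positivity upower_distC upower_dist_triangle.

HB.instance Definition _ := isPointed.Build upower (cls (fun _ _ => point)).

Lemma upower_mdistE (x y : upower) : mdist x y = upower_dist x y.
Proof. by []. Qed.

(* Countable saturation: row [n] of the limit copies row [n] of the latest [f k],
   [k <= n], whose distances to its predecessors are already visible in row [n]. *)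
Lemma family_dist_complete (f : nat -> nat -> nat -> M) :
  (forall j k, (j <= k)%N -> family_dist (f j) (f k) < 2^-1 ^+ j) ->
  exists g, forall j, family_dist (f j) g <= 2^-1 ^+ j.
Proof.
move=> fcau.
pose dn j k n := average (fun n i => mdist (f j n i) (f k n i)) n.
(* The clause [k <= n] makes a largest good [k] exist for each [n]. For fixed [j], almost every [n]
   has [j] good, so the maximum [K n] is at least [j] and its own goodness bounds the distance from
   [f j] to [f (K n)] in row [n]. *)
pose good k n := (k <= n)%N /\
  forall j k', (j <= k')%N -> (k' <= k)%N -> dn j k' n < 2^-1 ^+ j.
have good_near k : \forall n \near ultra, good k n.
  near=> n; split; first by near: n; apply: ultra_eventually; exact: nbhs_infty_ge.
  suff H : forall p : 'I_k.+1 * 'I_k.+1, (p.1 <= p.2)%N -> dn p.1 p.2 n < 2^-1 ^+ p.1.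
    move=> j k' jk' k'k; have jk := leq_trans jk' k'k.
    exact: (H (Ordinal (jk : (j < k.+1)%N), Ordinal (k'k : (k' < k.+1)%N))).
  near: n; apply: filter_forall => -[j k'] /=.
  have [jk'|_] := leqP j k'; last exact: nearW.
  have : \forall n \near ultra, dn j k' n < 2^-1 ^+ j.
    by apply: mean_lt_near; [exact: bounded2_mdist|exact: fcau].
  by apply: filterS.
have good0 n : exists k, `[< good k n >].
  exists 0; apply/asboolP; split=> // j [|//]; rewrite leqn0 => /eqP-> _.
  rewrite /dn (_ : (fun _ _ => _) = fun _ _ => 0) ?average_cst ?expr0//.
  by do 2 apply: funext => ?; exact: mdistxx.
have goodb n k : `[< good k n >] -> (k <= n)%N by move=> /asboolP[].
pose K n := ex_maxn (good0 n) (goodb n).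
exists (fun n i => f (K n) n i) => j.
apply: mean_le_near; first exact: bounded2_mdist.
near=> n.
have : good j n by near: n; exact: good_near.
move=> jn; rewrite [average _ _](_ : _ = dn j (K n) n)//.
rewrite /K; case: ex_maxnP => k /asboolP[_ kn] kmax.
by apply/ltW/kn => //; apply: kmax; exact/asboolP.
Unshelve. all: by end_near. Qed.

Lemma half_expr_lt (e : R) : 0 < e -> exists j, 2^-1 ^+ j < e.
Proof.
move=> e0; have half1 : `|2^-1 : R| < 1 by rewrite ger0_norm; lra.
have /cvgr_lt/(_ _ e0) := cvg_expr half1.
by move=> [j _ Hj]; exists j; exact: Hj (leqnn j).
Qed.

Lemma upower_cauchy_cvg (F : set_system upower) : ProperFilter F -> cauchy F -> cvg F.
Proof.
move=> FF /cauchyP Fc.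
(* Any two of the chosen balls meet, so for [j <= k] the centres are within [2^-1 ^+ j / 2], inside
   the rate that [family_dist_complete] expects. *)
pose r j : R := 2^-1 ^+ j / 4.
have r0 j : 0 < r j by rewrite divr_gt0// exprn_gt0.
have /choice[x Fx] j : exists x, F (ball x (r j)) by exact: Fc.
have xx j k : (j <= k)%N -> family_dist (rep (x j)) (rep (x k)) < 2^-1 ^+ j.
  move=> jk; have [y [yj yk]] := filter_ex (filterI (Fx j) (Fx k)).
  rewrite !ballEmdist /= in yj yk.
  have := metric_triangle (x j) y (x k); rewrite (metric_sym y).
  have : (2^-1 ^+ k : R) <= 2^-1 ^+ j by apply: ler_wiXn2l => //; lra.
  have := r0 j; rewrite /r in r0 yj yk *.
  by rewrite !upower_mdistE /upower_dist in yj yk *; lra.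
have [g Hg] := family_dist_complete xx.
apply/cvg_ex; exists (cls g).
apply/metricType_numDomainType.fcvgrPdist_lt => e e0.
have e2 : 0 < e / 2 by lra.
have [j je] := half_expr_lt e2.
apply: filterS (Fx j) => y; rewrite ballEmdist /= => yj.
have xg : mdist (x j) (cls g) <= 2^-1 ^+ j.
  by rewrite -(repK (x j)) upower_mdistE upower_dist_cls; exact: Hg.
have := metric_triangle (cls g) (x j) y; rewrite (metric_sym (cls g) (x j)).
by rewrite /r in yj; lra.
Qed.

HB.instance Definition _ := Uniform_isComplete.Build upower upower_cauchy_cvg.

End PowerUltraproduct.

(** * The ultraproduct as a structure, and its affine formulas *)

Section UpowerStructure.
Context {R : realType} {L : signature R} (M : structure L).
Implicit Types (V I : Type).

Lemma bounded2_formula V (phi : formula L V) (e : nat -> nat -> V -> M) :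
  bounded2 (fun n i => eval_formula phi (e n i)).
Proof. by have [B _ HB] := formula_bounded phi; exists B => n i. Qed.

Lemma bounded2_pred (P : pred_symbol L) (a : nat -> nat -> 'I_(pred_arity P) -> M) :
  bounded2 (fun n i => pred_interp (a n i)).
Proof.
exists (`|pred_lower P| + `|pred_upper P|) => n i.
have /andP[] := pred_interp_bound (a n i).
rewrite ler_norml => h1 h2.
have := ler_norm (pred_upper P); have := ler_norm (- pred_lower P).
have := normr_ge0 (pred_upper P); have := normr_ge0 (pred_lower P).
by rewrite normrN => *; apply/andP; split; lra.
Qed.

Lemma family_func_modulus (F : func_symbol L)
    (a b : 'I_(func_arity F) -> nat -> nat -> M) :
  func_modulus F (family_dist (fun n i => func_interp (fun j => a j n i))
                              (fun n i => func_interp (fun j => b j n i)))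
    <= \sum_j family_dist (a j) (b j).
Proof.
rewrite /family_dist -mean_sum => [|j]; last exact: bounded2_mdist.
apply: modulus_mean_jensen => [||n i|n i].
- exact: bounded2_mdist.
- by apply: bounded2_sum => j; exact: bounded2_mdist.
- exact: mdist_ge0.
- exact: func_interp_modulus.
Qed.

Lemma family_pred_modulus (P : pred_symbol L)
    (a b : 'I_(pred_arity P) -> nat -> nat -> M) :
  pred_modulus P `|mean (fun n i => pred_interp (fun j => a j n i))
                   - mean (fun n i => pred_interp (fun j => b j n i))|
    <= \sum_j family_dist (a j) (b j).
Proof.
rewrite /family_dist -mean_sum => [|j]; last exact: bounded2_mdist.
apply: (@le_trans _ _ (pred_modulus P (mean (fun n i =>
    `|pred_interp (fun j => a j n i) - pred_interp (fun j => b j n i)|)))).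
  by apply: modulus_le => //; apply: mean_abs_sub; exact: bounded2_pred.
apply: modulus_mean_jensen => [||n i|n i] //.
- have [B HB] := bounded2D (bounded2_pred (fun n i j => a j n i))
    (bounded2Z (-1) (bounded2_pred (fun n i j => b j n i))).
  by exists B => n i; rewrite normr_id; have := HB n i; rewrite mulN1r.
- by apply: bounded2_sum => j; exact: bounded2_mdist.
- exact: pred_interp_modulus.
Qed.

Lemma upower_mdist_diameter (x y : upower M) : mdist x y <= diameter L.
Proof.
by apply: mean_le_cst => [|n i]; [exact: bounded2_mdist|exact: mdist_diameter].
Qed.

Definition upower_func (F : func_symbol L) (a : 'I_(func_arity F) -> upower M) :
    upower M :=
  cls (fun n i => func_interp (fun j => rep (a j) n i)).

Lemma upower_func_modulus (F : func_symbol L) (a b : 'I_(func_arity F) -> upower M) :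
  func_modulus F (mdist (upower_func a) (upower_func b)) <= \sum_i mdist (a i) (b i).
Proof. rewrite upower_mdistE upower_dist_cls; exact: family_func_modulus. Qed.

Definition upower_pred (P : pred_symbol L) (a : 'I_(pred_arity P) -> upower M) : R :=
  mean (fun n i => pred_interp (fun j => rep (a j) n i)).

Lemma upower_pred_modulus (P : pred_symbol L) (a b : 'I_(pred_arity P) -> upower M) :
  pred_modulus P `|upower_pred a - upower_pred b| <= \sum_i mdist (a i) (b i).
Proof. exact: family_pred_modulus. Qed.

Lemma upower_pred_bound (P : pred_symbol L) (a : 'I_(pred_arity P) -> upower M) :
  pred_lower P <= upower_pred a <= pred_upper P.
Proof.
have bnd n i := pred_interp_bound (fun j => rep (a j) n i).
apply/andP; split.
  by apply: mean_ge_cst => [|n i]; [exact: bounded2_pred|case/andP: (bnd n i)].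
by apply: mean_le_cst => [|n i]; [exact: bounded2_pred|case/andP: (bnd n i)].
Qed.

Definition upower_structure : structure L :=
  @Structure R L (upower M) upower_mdist_diameter upower_func upower_func_modulus
    upower_pred upower_pred_modulus upower_pred_bound.

(** Replacing a family by the chosen representative of its class changes it by distance 0, and a
    modulus forces function symbols to preserve distance 0. *)
Lemma eval_term_upower V (t : term L V) (e : V -> nat -> nat -> M) :
  eval_term t ((fun v => cls (e v)) : V -> upower_structure) =
  cls (fun n i => eval_term t (fun v => e v n i)).
Proof.
elim: t => [//|F ts IH] /=; apply: eq_cls; apply: (modulus_eq0 (D := func_modulus F)).
  exact: family_dist_ge0.
apply: (le_trans (family_func_modulus _ _)); rewrite le_eqVlt big1 ?eqxx// => j _.
by rewrite IH cls_rep.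
Qed.

(** An affine form of Los's theorem. Linearity of [mean] handles connectives, which is where
    affinity is used; quantifiers commute with [mean] because a family may choose its element at
    each coordinate [(n, i)] independently. *)
Lemma eval_affine_upower V (phi : formula L V) : affine phi ->
  forall e : V -> nat -> nat -> M,
  eval_formula phi ((fun v => cls (e v)) : V -> upower_structure) =
  mean (fun n i => eval_formula phi (fun v => e v n i)).
Proof.
have extE W (e : W -> nat -> nat -> M) (g : nat -> nat -> M) :
    oapp ((fun v => cls (e v)) : W -> upower_structure) (cls g) =
    (fun v => cls (oapp e g v)) by apply: funext => -[].
have extE' W (e : W -> nat -> nat -> M) (g : nat -> nat -> M) n i :
    (fun v => oapp e g v n i) = oapp (fun v => e v n i) (g n i).
  by apply: funext => -[].
elim: phi => {V} [V P ts|V t1 t2|V m u phis IH|V phi IH|V phi IH].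
- move=> _ e /=; rewrite /upower_pred; apply/eqP; rewrite -subr_eq0 -normr_eq0.
  apply/eqP; apply: (modulus_eq0 (D := pred_modulus P)) => //.
  apply: (le_trans (family_pred_modulus _ _)); rewrite le_eqVlt big1 ?eqxx// => j _.
  by rewrite eval_term_upower cls_rep.
- by move=> _ e /=; rewrite !eval_term_upower; exact: upower_dist_cls.
- move=> [[c [w uE]] phi_aff] e /=; rewrite uE.
  rewrite (eq_bigr _ (fun j _ => congr1 (fun x => w j * x)
    (etrans (mxE _ _ _ _) (IH j (phi_aff j) e)))).
  pose F j n i : R := w j * eval_formula (phis j) (fun v => e v n i).
  have Fb j : bounded2 (F j) by apply: bounded2Z; exact: bounded2_formula.
  rewrite (_ : (fun n i => _) = (fun n i => c + \sum_j F j n i)); last first.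
    do 2 apply: funext => ?; rewrite uE; congr (_ + _).
    by apply: eq_bigr => j _; rewrite mxE.
  rewrite meanD ?mean_cst ?mean_sum//; [|exact: bounded2_cst|exact: bounded2_sum].
  by congr (_ + _); apply: eq_bigr => j _; rewrite meanZ//; exact: bounded2_formula.
- move=> phi_aff e; apply/eqP; rewrite eq_le; apply/andP; split.
    apply/eval_FSup_le => x; rewrite -(repK x) extE IH//.
    apply: mean_le => [||n i]; try exact: bounded2_formula.
    by rewrite extE'; exact: (iffLR (eval_FSup_le _ _ _) (lexx _)).
  apply/ler_addgt0Pr => eps eps0.
  have near_sup n i : exists x, eval_formula (FSup phi) (fun v => e v n i) - eps <=
      eval_formula phi (oapp (fun v => e v n i) x).
    apply: contrapT => no_x.
    suff : eval_formula (FSup phi) (fun v => e v n i) <=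
      eval_formula (FSup phi) (fun v => e v n i) - eps by lra.
    apply/eval_FSup_le => x; rewrite leNgt; apply/negP => lt_x.
    by apply: no_x; exists x; exact: ltW.
  pose g n i := sval (cid (near_sup n i)).
  have := iffLR (eval_FSup_le _ _ _) (lexx (eval_formula (FSup phi)
    ((fun v => cls (e v)) : V -> upower_structure))) (cls g).
  rewrite extE IH// -lerBlDr; apply: le_trans.
  rewrite -[X in _ - X]mean_cst -mulN1r -meanZ; last exact: bounded2_cst.
  rewrite -meanD; [|exact: bounded2_formula|exact/bounded2Z/bounded2_cst].
  apply: mean_le => [||n i].
  + by apply: bounded2D; [exact: bounded2_formula|exact/bounded2Z/bounded2_cst].
  + exact: bounded2_formula.
  + by rewrite extE' mulN1r; exact: (svalP (cid (near_sup n i))).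
- move=> phi_aff e; apply/eqP; rewrite eq_le; apply/andP; split; last first.
    apply/eval_FInf_ge => x; rewrite -(repK x) extE IH//.
    apply: mean_le => [||n i]; try exact: bounded2_formula.
    by rewrite extE'; exact: (iffLR (eval_FInf_ge _ _ _) (lexx _)).
  apply/ler_addgt0Pr => eps eps0.
  have near_inf n i : exists x, eval_formula phi (oapp (fun v => e v n i) x) <=
      eval_formula (FInf phi) (fun v => e v n i) + eps.
    apply: contrapT => no_x.
    suff : eval_formula (FInf phi) (fun v => e v n i) + eps <=
      eval_formula (FInf phi) (fun v => e v n i) by lra.
    apply/eval_FInf_ge => x; rewrite leNgt; apply/negP => lt_x.
    by apply: no_x; exists x; exact: ltW.
  pose g n i := sval (cid (near_inf n i)).
  have := iffLR (eval_FInf_ge _ _ _) (lexx (eval_formula (FInf phi)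
    ((fun v => cls (e v)) : V -> upower_structure))) (cls g).
  rewrite extE IH// => /le_trans; apply.
  rewrite -[X in _ <= _ + X]mean_cst -meanD;
    [|exact: bounded2_formula|exact: bounded2_cst].
  apply: mean_le => [||n i].
  + exact: bounded2_formula.
  + by apply: bounded2D; [exact: bounded2_formula|exact: bounded2_cst].
  + by rewrite extE'; exact: (svalP (cid (near_inf n i))).
Qed.

End UpowerStructure.

(* Derandomised law of large numbers: choosing each index so as not to increase
   the square of the running sum by more than [C] keeps the sums of size [sqrt N]. *)
Lemma greedy_choice (R : realType) (m p : nat) (lambda : 'I_m -> R)
    (d : nat -> 'I_m -> 'I_p -> R) (C : R) :
  (forall j, 0 <= lambda j) -> \sum_j lambda j = 1 ->
  (forall t s, \sum_j lambda j * d t j s = 0) ->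
  (forall t j, \sum_s d t j s ^+ 2 <= C) ->
  exists c : nat -> 'I_m, forall N, \sum_s (\sum_(t < N) d t (c t) s) ^+ 2 <= N%:R * C.
Proof.
move=> l0 l1 dmean dC.
have step t (S : 'I_p -> R) : exists j,
    \sum_s (S s + d t j s) ^+ 2 <= \sum_s S s ^+ 2 + C.
  pose f j := \sum_s (S s + d t j s) ^+ 2.
  (* Average over [j] with weights [lambda]: the cross terms vanish since [d t] has weighted mean 0.
     A minimising [j] does at least as well as the average. *)
  have avg : \sum_j lambda j * f j <= \sum_s S s ^+ 2 + C.
    apply: (@le_trans _ _ (\sum_j (lambda j * (\sum_s S s ^+ 2 + C) +
        \sum_s 2 * S s * (lambda j * d t j s)))).
      apply: ler_sum => j _.
      have -> : \sum_s 2 * S s * (lambda j * d t j s) = lambda j * \sum_s 2 * S s * d t j s.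
        by rewrite mulr_sumr; apply: eq_bigr => s _; ring.
      rewrite -mulrDr ler_wpM2l//.
      apply: (@le_trans _ _ (\sum_s S s ^+ 2 + \sum_s d t j s ^+ 2 + \sum_s 2 * S s * d t j s)).
        rewrite -!big_split /= /f le_eqVlt; apply/orP; left; apply/eqP.
        by apply: eq_bigr => s _; ring.
      by rewrite lerD2r lerD2l.
    rewrite big_split /= -mulr_suml l1 mul1r exchange_big /= gerDl.
    rewrite big1// => s _.
    by rewrite -mulr_sumr dmean mulr0.
  have m0 : (0 < m)%N.
    rewrite lt0n; apply/eqP => m0; subst m; move: l1.
    by rewrite big_ord0 => /esym/eqP; rewrite oner_eq0.
  case: (@arg_minP _ _ _ (Ordinal m0) xpredT f isT) => j _ jmin.
  exists j; apply: le_trans avg; rewrite -/(f j) -[leLHS]mul1r -l1 mulr_suml.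
  by apply: ler_sum => j' _; rewrite ler_wpM2l// jmin.
pose pick t S := sval (cid (step t S)).
pose fix S (N : nat) : 'I_p -> R :=
  if N is N'.+1 then fun s => S N' s + d N' (pick N' (S N')) s else fun=> 0.
exists (fun t => pick t (S t)).
have SE N s : \sum_(t < N) d t (pick t (S t)) s = S N s.
  by elim: N => [|N IH]; rewrite ?big_ord0// big_ord_recr /= IH.
elim=> [|N IH].
  by rewrite mul0r big1// => s _; rewrite big_ord0 expr0n.
under eq_bigr => s _ do rewrite SE.
apply: (le_trans (svalP (cid (step N (S N))))).
rewrite -natr1 mulrDl mul1r lerD2r; apply: le_trans IH.
by rewrite le_eqVlt; apply/orP; left; apply/eqP/eq_bigr => s _; rewrite SE.
Qed.

Section UpowerModels.
Context {R : realType} {L : signature R} (M : structure L).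

(** The witness copies, at coordinate [(n, i)], the tuple [x (c n i)]; in row [n], [c n] is the
    greedy choice for the deviations [d n] of the values from their weighted averages. *)
Lemma upower_CR : models (upower_structure M) (CR L).
Proof.
move=> _ [k [l [m [q [lambda [phi [l0 l1 phi_aff ->]]]]]]].
apply/models_CR => x y eps eps0.
pose env (j : 'I_m) (n i : nat) : 'I_k + 'I_l -> M :=
  join_env (fun p => rep (x j p) n i) (fun r => rep (y r) n i).
pose v j s n i := eval_formula (phi s) (env j n i).
have [B B0 phiB] := formulas_bounded phi.
pose d n t j s := v j s n t - \sum_j' lambda j' * v j' s n t.
have dB n t j s : `|d n t j s| <= 2 * B.
  apply: (le_trans (ler_normB _ _)); rewrite (_ : 2 * B = B + B); last by ring.
  apply: lerD; first exact: phiB.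
  apply: (le_trans (ler_norm_sum _ _ _)); rewrite -[leRHS]mul1r -l1 mulr_suml.
  by apply: ler_sum => j' _; rewrite normrM ger0_norm// ler_wpM2l// phiB.
pose C : R := \sum_(s < q.+1) (2 * B) ^+ 2.
(* One choice must serve all the formulas [phi s] at once, hence the sum over [s] of the squares. *)
have /choice[c Hc] n : exists c : nat -> 'I_m, forall N,
    \sum_s (\sum_(t < N) d n t (c t) s) ^+ 2 <= N%:R * C.
  apply: (greedy_choice l0 l1) => [t s|t j].
    under eq_bigr do rewrite mulrBr.
    by rewrite sumrB -mulr_suml l1 mul1r subrr.
  apply: ler_sum => s _; rewrite -real_normK ?num_real//.
  by rewrite lerXn2r ?nnegrE// mulr_ge0.
pose zz p n i := rep (x (c n i) p) n i.
exists (fun p => cls (zz p)) => s.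
have -> : eval_formula (phi s) (join_env (fun p => cls (zz p)) y : _ -> upower_structure M) =
    mean (fun n i => v (c n i) s n i).
  have -> : (join_env (fun p => cls (zz p)) y : _ -> upower_structure M) =
      (fun w => cls (join_env zz (fun r => rep (y r)) w)).
    by apply: funext => -[//|r] /=; rewrite repK.
  rewrite eval_affine_upower//; congr mean.
  by do 2 apply: funext => ?; congr eval_formula; apply: funext => -[].
have evalx j : eval_formula (phi s) (join_env (x j) y : _ -> upower_structure M) =
    mean (v j s).
  have -> : (join_env (x j) y : _ -> upower_structure M) =
      (fun w => cls (join_env (fun p => rep (x j p)) (fun r => rep (y r)) w)).
    by apply: funext => -[p|r] /=; rewrite repK.
  rewrite eval_affine_upower//; congr mean.
  by do 2 apply: funext => ?; congr eval_formula; apply: funext => -[].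
have vb j : bounded2 (v j s) by exact: bounded2_formula.
under eq_bigr do rewrite evalx -meanZ//.
have lvb j : bounded2 (fun n i => lambda j * v j s n i) by exact: bounded2Z.
have vcb : bounded2 (fun n i => v (c n i) s n i) by exists B => n i; exact: phiB.
rewrite -mean_sum// -mulN1r -meanZ; last exact: bounded2_sum.
rewrite -meanD//; last exact/bounded2Z/bounded2_sum.
rewrite (_ : (fun n i => _) = fun n i => d n i (c n i) s); last first.
  by do 2 apply: funext => ?; rewrite /d mulN1r.
have db : bounded2 (fun n i => d n i (c n i) s) by exists (2 * B) => n i; exact: dB.
(* Row [n] has [n.+1] columns, so the squared sum is at most [n.+1%:R * C], which is below
   [(eps * n.+1%:R) ^+ 2] as soon as [C / eps ^+ 2 <= n.+1%:R]. *)
have avg_small : \forall n \near ultra, `|average (fun n i => d n i (c n i) s) n| <= eps.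
  apply: ultra_eventually; near=> n.
  rewrite /average normrM normfV normr_nat ler_pdivrMr//.
  rewrite -(@ler_pXn2r _ 2)// ?nnegrE// ?mulr_ge0 ?(ltW eps0)//.
  rewrite real_normK ?num_real//.
  apply: (@le_trans _ _ (n.+1%:R * C)).
    apply: le_trans (Hc n n.+1); rewrite (bigD1 s)//= lerDl sumr_ge0// => s' _.
    exact: sqr_ge0.
  have CN : C / eps ^+ 2 <= n.+1%:R.
    have nge : C / eps ^+ 2 <= n%:R by near: n; exact: nbhs_infty_ger.
    by apply: (le_trans nge); rewrite ler_nat.
  rewrite ler_pdivrMr ?exprn_gt0// in CN.
  rewrite (_ : (eps * _) ^+ 2 = n.+1%:R * (n.+1%:R * eps ^+ 2)); last by ring.
  by rewrite ler_wpM2l.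
rewrite ler_norml; apply/andP; split.
  by apply: mean_ge_near => //; apply: filterS avg_small => n; rewrite ler_norml => /andP[].
by apply: mean_le_near => //; apply: filterS avg_small => n; rewrite ler_norml => /andP[].
Unshelve. all: by end_near. Qed.

End UpowerModels.

(** * Type spaces *)

Lemma initial_cvgP (S : choiceType) (T : topologicalType) (f : S -> T)
    (F : set_system (initial_topology f)) (x : initial_topology f) :
  Filter F -> F --> x <-> f @ F --> f x.
Proof.
move=> FF; split=> [Fx|fF U [V [[W oW <-]]] Wfx /filterS]; last first.
  by apply; apply: fF; exact: open_nbhs_nbhs.
by move=> N fN; apply: Fx; exact: (@initial_continuous _ _ f x N fN).
Qed.

Lemma ptws_cvgP (U : Type) (T : topologicalType) (F : set_system {ptws U -> T})
    (f : {ptws U -> T}) :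
  Filter F -> F --> f <-> forall u, (fun g : U -> T => g u) @ F --> f u.
Proof.
move=> FF; rewrite cvg_sup; split=> Ff u; have := Ff u.
  by move=> /(@initial_cvgP _ _ (fun g : prod_topology (fun=> T) => g u)).
by move=> Ffu; apply/(@initial_cvgP _ _ (fun g : prod_topology (fun=> T) => g u)).
Qed.

Lemma set_type_ptws_cvgP (U : Type) (T : topologicalType) (A : set {ptws U -> T})
    (F : set_system (set_type A : topologicalType)) (p : set_type A) :
  Filter F -> F --> p <-> forall u, (fun q : set_type A => set_val q u) @ F --> set_val p u.
Proof. by move=> FF; rewrite initial_cvgP ptws_cvgP. Qed.

(** * The diagonal embedding *)

Section Diagonal.
Context {R : realType} {L : signature R}.

Definition diagonal (M : structure L) (V : Type) (a : V -> M) : V -> upower_structure M :=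
  fun v => cls (fun _ _ => a v).

Lemma eval_diagonal (M : structure L) (V : Type) (phi : formula L V) (a : V -> M) :
  affine phi -> eval_formula phi (diagonal a) = eval_formula phi a.
Proof. by move=> phi_aff; rewrite eval_affine_upower// mean_cst. Qed.

Lemma mdist_diagonal (M : structure L) (V : Type) (a b : V -> M) v :
  mdist (diagonal a v) (diagonal b v) = mdist (a v) (b v).
Proof. by rewrite /diagonal upower_mdistE upower_dist_cls /family_dist mean_cst. Qed.

Lemma eval_sentence_upower (M : structure L) (phi : sentence L) :
  affine phi -> eval_sentence (upower_structure M) phi = eval_sentence M phi.
Proof.
move=> phi_aff; rewrite /eval_sentence -(eval_diagonal (@of_void M) phi_aff).
by congr eval_formula; apply: funext => -[].
Qed.

Lemma satisfies_upower (M : structure L) (c : condition L) :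
  affine_condition c -> satisfies (upower_structure M) c <-> satisfies M c.
Proof. by case: c => phi psi [/= ? ?]; rewrite !eval_sentence_upower. Qed.

Lemma models_upower (T : theory L) (M : structure L) :
  affine_theory T -> models M T -> models (upower_structure M) (T_CR T).
Proof.
move=> hT MT c [Tc|]; last exact: upower_CR.
by apply/satisfies_upower; [exact: hT|exact: MT].
Qed.

Lemma determined_by_affine (V : Type) (M N : structure L) (a : V -> M) (b : V -> N) :
  models M (CR L) -> models N (CR L) ->
  (forall psi, affine psi -> eval_formula psi a = eval_formula psi b) ->
  forall phi, eval_formula phi a = eval_formula phi b.
Proof.
move=> hM hN ab phi; apply/eqP; rewrite -subr_eq0 -normr_le0.
apply/ler_addgt0Pr => eps eps0; rewrite add0r.
have [J [psi [d [d0 psi_aff H]]]] := all_determined phi eps0.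
by apply: H => // j; rewrite ab// subrr normr0 ltW.
Qed.

Lemma models_T_CR (T : theory L) (M : structure L) :
  models M (T_CR T) -> models M T /\ models M (CR L).
Proof. by move=> h; split=> c hc; apply: h; [left|right]. Qed.

End Diagonal.

Section TypeSpaces.
Context {R : realType} {L : signature R} {T : theory L} (hT : affine_theory T) {X : Type}.
Implicit Types (p q : S_cont (T_CR T) X).

Lemma S_contP p : exists (M : structure L) (a : X -> M),
  models M (T_CR T) /\ cont_realizes a (set_val p).
Proof. exact: set_mem (svalP p). Qed.

Lemma S_affP (q : S_aff T X) : exists (M : structure L) (a : X -> M),
  models M T /\ aff_realizes a (set_val q).
Proof. exact: set_mem (svalP q). Qed.

(** [p] is realised in some model of CR, and two tuples in models of CR with equal affine values
    agree on all formulas. Both injectivity of [rho_aff] and the isometry depend on this. *)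
Lemma realizes_rho_aff p (M : structure L) (a : X -> M) : models M (T_CR T) ->
  aff_realizes a (set_val (rho_aff p)) -> cont_realizes a (set_val p).
Proof.
move=> /models_T_CR[_ hM] ap phi; have [N [b [/models_T_CR[_ hN] bp]]] := S_contP p.
rewrite bp; apply: determined_by_affine => // psi psi_aff.
by rewrite -bp -(ap (exist _ psi psi_aff)).
Qed.

Lemma realizes_diagonal (M : structure L) (a : X -> M) p : models M T ->
  aff_realizes a (set_val (rho_aff p)) -> cont_realizes (diagonal a) (set_val p).
Proof.
move=> MT ap; apply: realizes_rho_aff; first exact: models_upower.
by move=> [phi phi_aff]; rewrite ap /= eval_diagonal.
Qed.

Lemma rho_aff_inj : injective (@rho_aff R L T X).
Proof.
move=> p q pq; apply: val_inj; apply: funext => phi.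
have [M [a [hM ap]]] := S_contP p.
have aq : cont_realizes a (set_val q).
  by apply: realizes_rho_aff => // psi; rewrite -pq; exact: ap.
exact: etrans (ap phi) (esym (aq phi)).
Qed.

Lemma rho_aff_surj (q : S_aff T X) : exists p, rho_aff p = q.
Proof.
have [M [a [MT aq]]] := S_affP q.
have hp : cont_types (T_CR T) X (fun phi => eval_formula phi (diagonal a)).
  by exists (upower_structure M), (diagonal a); split=> //; exact: models_upower.
exists (exist (fun r => r \in cont_types (T_CR T) X) _ (mem_set hp)).
apply: val_inj; apply: funext => -[phi phi_aff].
exact: etrans (eval_diagonal a phi_aff) (esym (aq (exist _ phi phi_aff))).
Qed.

Lemma rho_aff_homeomorphism : homeomorphism (@rho_aff R L T X).
Proof.
have cvg_val (U : Type) (A : set {ptws U -> R}) (p : set_type A) u :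
    (fun q : set_type A => set_val q u) @ p --> set_val p u.
  have := @set_type_ptws_cvgP U R A (nbhs p) p _; move=> [+ _]; apply.
  exact: cvg_id.
split=> [p|].
  apply/set_type_ptws_cvgP; first exact: (@fmap_filter _ _ _ _ (nbhs_filter p)).
  by move=> phi; exact: (cvg_val _ (cont_types (T_CR T) X) p (sval phi)).
pose g (r : S_aff T X) := sval (cid (rho_aff_surj r)).
have gK r : rho_aff (g r) = r := svalP (cid (rho_aff_surj r)).
exists g; split=> //; first by move=> p; apply: rho_aff_inj; exact: gK.
move=> r; have rF : Filter (nbhs r) := nbhs_filter r.
apply/set_type_ptws_cvgP => phi; apply/cvgrPdist_le => eps eps0.
(* Continuity of the inverse: closeness on the finitely many [psi j], a neighbourhood condition in
   the affine type space, controls [phi] up to [eps]. *)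
have [J [psi [d [d0 psi_aff H]]]] := all_determined phi eps0.
have gE s j : set_val (g s) (psi j) = set_val s (exist _ (psi j) (psi_aff j)).
  by rewrite -[in RHS](gK s).
suff : \forall s \near r, `|set_val (g r) phi - set_val (g s) phi| <= eps by [].
near=> s.
have [M [a [/models_T_CR[_ hM] ap]]] := S_contP (g r).
have [N [b [/models_T_CR[_ hN] bp]]] := S_contP (g s).
rewrite ap bp; apply: H => // j; rewrite -ap -bp !gE.
move: j; near: s; apply: filter_forall => j.
by have /cvgrPdist_le := cvg_val _ (aff_types T X) r (exist _ (psi j) (psi_aff j)); apply.
Unshelve. all: by end_near. Qed.

(** The two infima range over the same set: the diagonal carries affine realisations to continuous
    ones at equal distance, and a model of [T_CR T] is a model of [T]. The case without common
    realisations is thereby included. *)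
Lemma rho_aff_isometry
    (d : forall M : metricType R, (X -> M) -> (X -> M) -> \bar R)
    (d_diag : forall (M : structure L) (a b : X -> M),
      d (upower_structure M) (diagonal a) (diagonal b) = d M a b) p q :
  aff_type_dist d (rho_aff p) (rho_aff q) = cont_type_dist d p q.
Proof.
congr ereal_inf.
apply/seteqP; split=> [r [M [a [b [MT ap bq ->]]]]|r [M [a [b [hM ap bq ->]]]]].
  exists (upower_structure M), (diagonal a), (diagonal b).
  by split; [exact: models_upower|exact: realizes_diagonal..|].
by exists M, a, b; split=> // [|phi|phi]; [case: (models_T_CR hM)|exact: ap|exact: bq].
Qed.

End TypeSpaces.

Theorem theorem17p7 (R : realType) (L : signature R) (T : theory L)
    (hT : affine_theory T) :
  [/\ equivalent (affine_consequences (T_CR T)) T,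
      delta_convex_reduction (T_CR T),
      [/\ forall X : Type, homeomorphism (@rho_aff R L T X),
          forall (n : nat) (p q : S_cont (T_CR T) 'I_n),
            aff_type_dist (@finite_dist R n) (rho_aff p) (rho_aff q) =
            cont_type_dist (@finite_dist R n) p q &
          forall p q : S_cont (T_CR T) nat,
            aff_type_dist (@countable_dist R) (rho_aff p) (rho_aff q) =
            cont_type_dist (@countable_dist R) p q] &
      affinely_complete T -> continuously_complete (T_CR T)].
Proof.
split=> [M|V phi eps eps0||T_complete M N hM hN phi].
- split=> [MT c Tc|MT c [c_aff hc]].
    apply: MT; split; first exact: hT.
    by move=> N hN; apply: hN; left.
  (* The ultraproduct satisfies the affine consequences of [T_CR T], and affine conditions descend
     to [M]. *)
  by apply/(satisfies_upower M c_aff)/hc; exact: models_upower.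
- have [psi dc_psi H] := delta_convex_approx phi eps0.
  by exists psi; split=> // M /models_T_CR[_ hM] a; exact: H.
- split=> [X|n p q|p q]; first exact: rho_aff_homeomorphism.
    apply: rho_aff_isometry => // M a b; congr EFin.
    by apply: eq_bigr => i _; rewrite mdist_diagonal.
  apply: rho_aff_isometry => // M a b; rewrite /countable_dist.
  by under eq_eseriesr => i _ do rewrite mdist_diagonal.
- have [MT hM'] := models_T_CR hM; have [NT hN'] := models_T_CR hN.
  apply: determined_by_affine => // psi psi_aff.
  exact: (T_complete M N MT NT psi psi_aff).
Qed.
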